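(* $$\frac{1}{1-t}+\frac{1}{1+y}\sum_{n=1}^\infty\left(\frac{1+yt}{1-t}\right)^{n+1}I_n^{(\mathrm{pk},\mathrm{des},\mathrm{fix})}\left(\frac{(1+y)^2t}{(y+t)(1+yt)},\frac{y+t}{1+yt},z\right)x^n=\sum_{k=0}^\infty\frac{(1+zxy)^k(1+x^2y)^{k^2}t^k}{(1-zx)^k(1-x^2)^{\binom k2}(1-x^2y^2)^{\binom{k+1}2}}.$$
   Context: For a permutation $\pi=\pi(1)\cdots\pi(n)$ of $[n]=\{1,\dots,n\}$, $\mathrm{des}(\pi)$ is the number of descents, i.e. $i\in[n-1]$ with $\pi(i)>\pi(i+1)$; $\mathrm{pk}(\pi)$ is the number of peaks, i.e. $i\in\{2,\dots,n-1\}$ with $\pi(i-1)<\pi(i)>\pi(i+1)$; $\mathrm{fix}(\pi)$ is the number of fixed points. $\mathfrak{I}_n$ is the set of involutions of $[n]$ (permutations $\pi$ with $\pi^2$ the identity), and $$I_n^{(\mathrm{pk},\mathrm{des},\mathrm{fix})}(y,t,z)=\sum_{\pi\in\mathfrak{I}_n}y^{\mathrm{pk}(\pi)+1}t^{\mathrm{des}(\pi)+1}z^{\mathrm{fix}(\pi)}.$$ The identity is between formal power series in $x$ and $t$; rational functions of $y,t$ are expanded as power series in $t$. *)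

(* Defs.v *)
From HB Require Import structures.
From mathcomp Require Import all_boot all_order all_algebra all_fingroup.
From mathcomp Require Import boolp classical_sets functions cardinality fsbigop.

Set Implicit Arguments.
Unset Strict Implicit.
Unset Printing Implicit Defensive.

Import GRing.Theory.

Local Open Scope ring_scope.

Section PermutationStatistics.

Variable n : nat.
Implicit Type s : 'S_n.

(* ['I_n] is {0, .., n-1}: the shift by one from [n] = {1, .., n} changes none
   of the statistics. *)
Definition involution s : bool := (s ^+ 2 == 1)%g.

Definition des s : nat :=
  #|[set i : 'I_n | [exists j : 'I_n, (j == i.+1 :> nat) && (s j < s i)%N]]|.

Definition pk s : nat :=
  #|[set i : 'I_n | [exists h : 'I_n, [exists j : 'I_n,
      [&& i == h.+1 :> nat, j == i.+1 :> nat, (s h < s i)%N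
        & (s j < s i)%N]]]]|.

Definition fixpts s : nat := #|[set i : 'I_n | s i == i]|.

End PermutationStatistics.

Definition I_pk_des_fix (R : comNzRingType) (n : nat) (y t z : R) : R :=
  \sum_(s : 'S_n | involution s)
     y ^+ (pk s).+1 * t ^+ (des s).+1 * z ^+ fixpts s.

(* A record rather than [nat -> R] itself, which already carries the pointwise
   ring structure. *)
Record fps (R : Type) := FPS { fcoef : nat -> R }.

Notation "{ 'fps' R }" := (fps R) (format "{ 'fps'  R }") : type_scope.

HB.instance Definition _ (R : Type) := gen_eqMixin (fps R).
HB.instance Definition _ (R : Type) := gen_choiceMixin (fps R).

Lemma fpsP (R : Type) (f g : {fps R}) : (forall n, fcoef f n = fcoef g n) <-> f = g.
Proof. by case: f g => [f] [g]; split=> [/funext /= -> //|-> //]. Qed.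

Section FpsRing.

Variable R : comNzRingType.
Implicit Types (c : R) (f g h : {fps R}).

Definition fps_zero : {fps R} := FPS (fun=> 0).
Definition fps_opp f : {fps R} := FPS (fun n => - fcoef f n).
Definition fps_add f g : {fps R} := FPS (fun n => fcoef f n + fcoef g n).
Definition fpsC c : {fps R} := FPS (fun n => if n == 0%N then c else 0).
Definition fpsX : {fps R} := FPS (fun n => (n == 1%N)%:R).
Definition fps_mul f g : {fps R} :=
  FPS (fun n => \sum_(i < n.+1) fcoef f i * fcoef g (n - i)).

Fact fps_addA : associative fps_add.
Proof. by move=> f g h; apply/fpsP => n /=; rewrite addrA. Qed.
Fact fps_addC : commutative fps_add.
Proof. by move=> f g; apply/fpsP => n /=; rewrite addrC. Qed.
Fact fps_add0 : left_id fps_zero fps_add.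
Proof. by move=> f; apply/fpsP => n /=; rewrite add0r. Qed.
Fact fps_addN : left_inverse fps_zero fps_opp fps_add.
Proof. by move=> f; apply/fpsP => n /=; rewrite addNr. Qed.

HB.instance Definition _ :=
  GRing.isZmodule.Build {fps R} fps_addA fps_addC fps_add0 fps_addN.

Definition fps_trunc n f : {poly R} := \poly_(i < n.+1) fcoef f i.

Lemma coef_fps_trunc n f i : (i <= n)%N -> (fps_trunc n f)`_i = fcoef f i.
Proof. by move=> le_in; rewrite coef_poly ltnS le_in. Qed.

Lemma coef_fps_mul_trunc n f g i : (i <= n)%N ->
  fcoef (fps_mul f g) i = (fps_trunc n f * fps_trunc n g)`_i.
Proof.
move=> le_in; rewrite coefM /=; apply: eq_bigr => j _.
rewrite !coef_fps_trunc //; first exact: leq_trans (leq_subr _ _) le_in.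
by rewrite (leq_trans _ le_in) // -ltnS.
Qed.

Fact fps_mulC : commutative fps_mul.
Proof.
move=> f g; apply/fpsP => n.
by rewrite !(coef_fps_mul_trunc _ _ (leqnn n)) mulrC.
Qed.

Fact fps_mulA : associative fps_mul.
Proof.
move=> f g h; apply/fpsP => n; rewrite /=.
transitivity ((fps_trunc n f * (fps_trunc n g * fps_trunc n h))`_n).
  rewrite coefM; apply: eq_bigr => j _; congr (_ * _).
    by rewrite coef_fps_trunc // -ltnS.
  by rewrite -coef_fps_mul_trunc ?leq_subr.
rewrite mulrA coefM; apply: eq_bigr => j _; congr (_ * _).
  by rewrite -coef_fps_mul_trunc // -ltnS.
by rewrite coef_fps_trunc ?leq_subr.
Qed.

Fact fps_mul1 : left_id (fpsC 1) fps_mul.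
Proof.
move=> f; apply/fpsP => n /=; rewrite big_ord_recl /= mul1r subn0 big1 ?addr0 //.
by move=> i _; rewrite mul0r.
Qed.

Fact fps_mulDl : left_distributive fps_mul fps_add.
Proof.
move=> f g h; apply/fpsP => n /=; rewrite -big_split /=.
by apply: eq_bigr => i _; rewrite mulrDl.
Qed.

Fact fps_oner_neq0 : fpsC 1 != fps_zero.
Proof. by apply/eqP => /fpsP /(_ 0%N) /eqP; rewrite /= oner_eq0. Qed.

HB.instance Definition _ := GRing.Zmodule_isComNzRing.Build {fps R}
  fps_mulA fps_mulC fps_mul1 fps_mulDl fps_oner_neq0.

Lemma fcoef0 n : fcoef (0 : {fps R}) n = 0. Proof. by []. Qed.
Lemma fcoefD f g n : fcoef (f + g) n = fcoef f n + fcoef g n.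
Proof. by []. Qed.
Lemma fcoefN f n : fcoef (- f) n = - fcoef f n. Proof. by []. Qed.
Lemma fcoefM f g n :
  fcoef (f * g) n = \sum_(i < n.+1) fcoef f i * fcoef g (n - i).
Proof. by []. Qed.
Lemma fcoef1 n : fcoef (1 : {fps R}) n = if n == 0%N then 1 else 0.
Proof. by []. Qed.

Lemma fcoefM0 f g : fcoef (f * g) 0 = fcoef f 0 * fcoef g 0.
Proof. by rewrite fcoefM big_ord_recl big_ord0 addr0. Qed.

Lemma fcoefCM c f n : fcoef (fpsC c * f) n = c * fcoef f n.
Proof.
rewrite fcoefM big_ord_recl /= subn0 big1 ?addr0 // => i _.
by rewrite mul0r.
Qed.

Lemma fcoefMX f n :
  fcoef (f * fpsX) n = if n == 0%N then 0 else fcoef f n.-1.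
Proof.
rewrite mulrC fcoefM; case: n => [|n].
  by rewrite big_ord_recl big_ord0 /= mul0r addr0.
rewrite !big_ord_recl big1 /= ?mul0r ?mul1r ?subSS ?subn0 ?addr0 ?add0r //.
by move=> i _; rewrite mul0r.
Qed.

Lemma fcoefMXn f k n :
  fcoef (f * fpsX ^+ k) n = if (n < k)%N then 0 else fcoef f (n - k).
Proof.
elim: k n => [|k IHk] n; first by rewrite expr0 mulr1 subn0.
rewrite exprSr mulrA fcoefMX; case: n => [|n]; first by [].
by rewrite -[LHS]/(fcoef (f * fpsX ^+ k) n) IHk ltnS subSS.
Qed.

Fact fpsC_is_zmod_morphism : zmod_morphism fpsC.
Proof.
move=> a b; apply/fpsP => n; rewrite fcoefD fcoefN /=.
by case: eqP => // _; rewrite subr0.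
Qed.

Fact fpsC_is_monoid_morphism : monoid_morphism fpsC.
Proof.
split=> // a b; apply/fpsP => n; rewrite fcoefM big_ord_recl /= subn0 big1.
  by case: eqP; rewrite ?mulr0 addr0.
by move=> i _; rewrite mul0r.
Qed.

HB.instance Definition _ :=
  GRing.isZmodMorphism.Build R {fps R} fpsC fpsC_is_zmod_morphism.
HB.instance Definition _ :=
  GRing.isMonoidMorphism.Build R {fps R} fpsC fpsC_is_monoid_morphism.

End FpsRing.

Arguments fpsX {R}.

Section FpsUnitRing.

Variable R : comUnitRingType.
Implicit Types f g : {fps R}.

Definition fps_unit : {pred {fps R}} := fun f => fcoef f 0 \is a GRing.unit.

(* [fps_inv_seq f n] lists the first n+1 coefficients of the inverse of f. *)
Fixpoint fps_inv_seq f (n : nat) : seq R :=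
  if n is m.+1 then
    rcons (fps_inv_seq f m)
      (- (fcoef f 0)^-1 *
         \sum_(i < m.+1) fcoef f i.+1 * (fps_inv_seq f m)`_(m - i))
  else [:: (fcoef f 0)^-1].

Definition fps_inv f : {fps R} :=
  if f \in fps_unit then FPS (fun n => (fps_inv_seq f n)`_n) else f.

Lemma size_fps_inv_seq f n : size (fps_inv_seq f n) = n.+1.
Proof. by elim: n => //= n IHn; rewrite size_rcons IHn. Qed.

Lemma nth_fps_inv_seq f n i : (i <= n)%N ->
  (fps_inv_seq f n)`_i = (fps_inv_seq f i)`_i.
Proof.
elim: n => [|n IHn]; first by rewrite leqn0 => /eqP ->.
rewrite leq_eqVlt => /predU1P [-> //|lt_in].
by rewrite /= nth_rcons size_fps_inv_seq lt_in IHn.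
Qed.

Fact fps_mulVf : {in fps_unit, left_inverse 1 fps_inv *%R}.
Proof.
move=> f Uf; rewrite mulrC /fps_inv Uf; apply/fpsP => n.
rewrite fcoefM fcoef1; case: n => [|n] /=.
  by rewrite big_ord_recl big_ord0 addr0 mulrV.
rewrite big_ord_recl /= nth_rcons subn0 size_fps_inv_seq ltnn eqxx.
rewrite mulNr mulrN mulrA mulrV // mul1r.
apply/eqP; rewrite addrC subr_eq0; apply/eqP; apply: eq_bigr => i _.
by rewrite /bump /= add1n subSS (nth_fps_inv_seq _ (leq_subr i n)).
Qed.

Fact fps_unitPl f g : g * f = 1 -> fps_unit f.
Proof.
move=> /fpsP /(_ 0%N); rewrite fcoefM0 fcoef1 /= => gf1.
by apply/unitrPr; exists (fcoef g 0); rewrite mulrC.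
Qed.

Fact fps_inv_out : {in [predC fps_unit], fps_inv =1 id}.
Proof. by move=> f /negPf Uf; rewrite /fps_inv [f \in _]Uf. Qed.

HB.instance Definition _ := GRing.ComNzRing_hasMulInverse.Build {fps R}
  fps_mulVf fps_unitPl fps_inv_out.

Lemma fps_unitE f : (f \is a GRing.unit) = (fcoef f 0 \is a GRing.unit).
Proof. by []. Qed.

End FpsUnitRing.

(* Series in x over series in t, i.e. A[[t]][[x]] = A[[x, t]], with coefficients
   A = Q(y)[z]: expanding 1/(y + t) in powers of t requires y to be
   invertible. *)
Notation Qyz := {poly {fraction {poly rat}}}.
Notation qyz_series := {fps {fps Qyz}}.

Definition vy : qyz_series := fpsC (fpsC ((@tofrac {poly rat} 'X)%:P : Qyz)).
Definition vz : qyz_series := fpsC (fpsC ('X : Qyz)).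
Definition vt : qyz_series := fpsC fpsX.
Definition vx : qyz_series := fpsX.

(* The coefficient of x^i t^j. *)
Definition coef_xt (R : comNzRingType) (f : {fps {fps R}}) (i j : nat) : R :=
  fcoef (fcoef f i) j.

Definition fps_summable (R : comNzRingType) (m : nat)
    (F : nat -> {fps {fps R}}) : Prop :=
  forall i j, finite_set [set k | (m <= k)%N /\ coef_xt (F k) i j <> 0]%classic.

(* The infinite sum over all k >= m, coefficient by coefficient; meaningful for
   summable families only, as [fsbigop] sums with infinite support are 0. *)
Definition fps_sum (R : comNzRingType) (m : nat)
    (F : nat -> {fps {fps R}}) : {fps {fps R}} :=
  FPS (fun i => FPS (fun j =>
    \sum_(k \in [set k | (m <= k)%N]%classic) coef_xt (F k) i j)).

Notation "\fps_sum_ ( m <= k ) F" := (fps_sum m (fun k => F%R))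
  (at level 41, F at level 41, m, k at level 50,
   format "'[' \fps_sum_ ( m  <=  k ) '/  '  F ']'") : ring_scope.

Lemma fps_summable_x m (F : nat -> qyz_series) :
  fps_summable m (fun k => F k * vx ^+ k).
Proof.
move=> i j; apply: (sub_finite_set (B := `I_i.+1)%classic); last exact: finite_II.
move=> k /= [_]; rewrite /coef_xt fcoefMXn ltnS leqNgt.
by case: ltnP => //= _ [].
Qed.

Lemma fps_summable_t m (F G : nat -> qyz_series) :
  fps_summable m (fun k => F k * vt ^+ k / G k).
Proof.
move=> i j; apply: (sub_finite_set (B := `I_j.+1)%classic); last exact: finite_II.
move=> k /= [_]; rewrite mulrAC mulrC /coef_xt /vt -rmorphXn fcoefCM.
by rewrite mulrC fcoefMXn ltnS leqNgt; case: ltnP => //= _ [].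
Qed.

Lemma fps_unit_vy : vy \is a GRing.unit.
Proof.
by rewrite !fps_unitE poly_unitE /= size_polyC coefC /= unitfE tofrac_eq0
           polyX_eq0.
Qed.

Lemma fps_unit_yDt : vy + vt \is a GRing.unit.
Proof. by have := fps_unit_vy; rewrite !fps_unitE !fcoefD /= addr0. Qed.

Lemma fps_unit_1Dy : 1 + vy \is a GRing.unit.
Proof.
have nz : 1 + @tofrac {poly rat} 'X != 0.
  rewrite -(tofrac1 {poly rat}) -tofracD tofrac_eq0.
  by rewrite addrC -size_poly_eq0 (size_XaddC (1 : rat)).
suff U : 1 + (@tofrac {poly rat} 'X)%:P \is a @GRing.unit Qyz.
  by rewrite !fps_unitE fcoefD.
rewrite -(polyC1 {fraction {poly rat}}) -polyCD poly_unitE size_polyC coefC /=.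
by rewrite nz unitfE nz.
Qed.

Lemma fps_unit_1Dyt : 1 + vy * vt \is a GRing.unit.
Proof. by rewrite !fps_unitE fcoefD !fcoefM0 /= mulr0 addr0 unitr1. Qed.

Lemma fps_unit_1Bt : 1 - vt \is a GRing.unit.
Proof. by rewrite !fps_unitE !fcoefD !fcoefN /= subr0 unitr1. Qed.

Lemma fps_unit_1BMx (f : qyz_series) : 1 - f * vx \is a GRing.unit.
Proof. by rewrite fps_unitE fcoefD fcoefN fcoefM0 /= mulr0 subr0 unitr1. Qed.

(* Main.v *)
Require Import Defs.
From HB Require Import structures.
From mathcomp Require Import boolp classical_sets fsbigop.
From mathcomp Require Import all_boot all_order all_algebra all_fingroup.
From mathcomp Require Import zify ring.

Set Implicit Arguments.
Unset Strict Implicit.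
Unset Printing Implicit Defensive.

Import GRing.Theory.

Local Open Scope ring_scope.

(** Order the 2k letters 1' < 1 < 2' < 2 < ... < k' < k.  A word a_0 ... a_(n-1)
    in them is compatible with a permutation s of its positions when it is
    weakly increasing, s increases along every run of an unprimed letter, and s
    decreases along every run of a primed one.  Both sides of the identity
    enumerate triples (k, s, a), with s an involution and a compatible with it,
    by t^k, x^length, z^fixed points and y^primed letters.

    The k-th term on the right is the sum over s and a, for fixed k.  Send (s, a)
    to the symmetric matrix M(b, c) counting the positions i with a_i = b and
    a_(s i) = c.  Cells of an unprimed and a primed letter hold at most one
    position, because s would have to be increasing and its own inverse
    decreasing on two of them; this is the only constraint, and M determines
    (s, a) ([compat_unique], [compat_exists]).  In the diagonal cell of an
    unprimed letter s is the identity; in that of a primed letter it is a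
    reversal, with one fixed point or none according to the parity of the cell.
    Hence the sum factors over unordered pairs of letters ([coef_prod_cell]):
    1/(1 - zx) and (1 + zxy)/(1 - x^2 y^2) for the diagonal cells, 1/(1 - x^2),
    1/(1 - x^2 y^2) and 1 + x^2 y for the others, which gives the closed form.

    The left side is the sum over k and a, for fixed s.  Write the letter a_i as
    a number c_i and a prime e_i.  Compatibility says that c_(i+1) >= c_i, with
    strict inequality exactly when s ascends from i to i+1 and a_(i+1) is primed,
    or s descends and a_i is unprimed ([compat_gaps]).  A weak step contributes
    1/(1 - t) and a strict one t/(1 - t), so that with the two end steps the sum
    over k and a is t/(1 - t)^(n+1) times the product over the positions of
      y t^[ascent on the left] + t^[descent on the right]
    ([gapcount_series]).  The factor is (1 + y) t at a peak, y + t at a double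
    descent, 1 + y t at a double ascent and 1 + y at a valley, the ends of s
    counting as if s were infinite outside.  There are pk s peaks, des s - pk s
    double descents and one more valley than peaks ([prod_stats]), so that up to
    powers of 1 + y and 1 + yt the product is a monomial in the substituted values
    of y and t ([perm_series]). *)

(** * Words compatible with a permutation *)

Section Compat.
Variables (A : finType) (key : A -> nat) (key_inj : injective key).
Variable primed : pred A.
Variable n : nat.
Implicit Types (s : 'S_n) (a : {ffun 'I_n -> A}) (p : A * A).

(** The relation that compatibility asks of positions i < j.  It compares
    arbitrary, not only adjacent, positions: it is transitive, so both readings
    agree, and the pairwise one needs no successor on ['I_n]. *)
Definition before s a (i j : 'I_n) : bool :=
  (key (a i) < key (a j))%N
  || (a i == a j) && (if primed (a i) then s j < s i else s i < s j)%N.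

Definition compat s a : bool :=
  [forall i : 'I_n, forall j : 'I_n, (i < j)%N ==> before s a i j].

Lemma compatP s a :
  reflect (forall i j : 'I_n, (i < j)%N -> before s a i j) (compat s a).
Proof.
apply: (iffP forallP) => [H i j|H i]; first by move/forallP: (H i) => /(_ j)/implyP.
by apply/forallP => j; apply/implyP; apply: H.
Qed.

(** The matrix attached to (s, a): the number of positions in cell p. *)
Definition mult s a p : nat := #|[set i | (a i, a (s i)) == p]|.

Lemma involutionP s : reflect (forall i, s (s i) = i) (involution s).
Proof.
apply: (iffP eqP) => [ss i|ss]; last by apply/permP => i; rewrite expgS expg1 permM ss perm1.
by rewrite -permM -[(s * s)%g]/(s ^+ 2)%g ss perm1.
Qed.

Lemma mult_sym s a b c : involution s -> mult s a (b, c) = mult s a (c, b).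
Proof.
move=> /involutionP ss; rewrite /mult -(card_imset _ (@perm_inj _ s)).
apply: eq_card => i; rewrite -[i in LHS]ss mem_imset ?inE; last exact: perm_inj.
by rewrite ss !xpair_eqE andbC.
Qed.

Lemma compat_key s a (i j : 'I_n) :
  compat s a -> (i <= j)%N -> (key (a i) <= key (a j))%N.
Proof.
move=> /compatP ca; rewrite leq_eqVlt => /predU1P [/val_inj -> //|/ca].
by case/orP => [/ltnW //|/andP [/eqP -> _]].
Qed.

(** The order in which the cells of the successive positions appear: within the
    block of a letter the images run forwards or backwards according to the
    prime. *)
Definition pairle p q : bool :=
  (key p.1 < key q.1)%N
  || (p.1 == q.1) && (if primed p.1 then key q.2 <= key p.2 else key p.2 <= key q.2)%N.

Lemma pairle_trans : transitive pairle.
Proof.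
move=> [q1 q2] [p1 p2] [r1 r2]; rewrite /pairle /=.
case/orP=> [lt1|/andP[/eqP-> h1]]; case/orP=> [lt2|/andP[/eqP e2 h2]].
- by rewrite (ltn_trans lt1 lt2).
- by rewrite -e2 lt1.
- by rewrite lt2.
- rewrite -e2 eqxx /= orbC; case: (primed q1) h1 h2 => h1 h2.
    by rewrite (leq_trans h2 h1).
  by rewrite (leq_trans h1 h2).
Qed.

Lemma pairle_anti : antisymmetric pairle.
Proof.
move=> [p1 p2] [q1 q2]; rewrite /pairle /= => /andP [].
case/orP=> [lt1|/andP[/eqP-> h1]]; case/orP=> [lt2|/andP[/eqP e2 h2]].
- by move: (ltn_trans lt1 lt2); rewrite ltnn.
- by move: lt1; rewrite e2 ltnn.
- by move: lt2; rewrite ltnn.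
- congr pair; apply: key_inj; apply/eqP; rewrite eqn_leq.
  by case: (primed q1) h1 h2 => -> ->.
Qed.

Definition pairs s a := [seq (a i, a (s i)) | i <- enum 'I_n].

Lemma sorted_enum_ord : sorted (fun i j : 'I_n => (i < j)%N) (enum 'I_n).
Proof.
by have := iota_ltn_sorted 0 n; rewrite -val_enum_ord sorted_map.
Qed.

Lemma sorted_pairs s a : compat s a -> sorted pairle (pairs s a).
Proof.
move=> ca; apply: homo_sorted sorted_enum_ord => i j lt_ij; rewrite /pairle /=.
move/compatP: (ca) => /(_ _ _ lt_ij) /orP [-> //|/andP [/eqP -> h]].
rewrite eqxx orbC /=; move: h.
by case: (primed _) => /ltnW le_s; rewrite (compat_key ca le_s).
Qed.

Lemma count_pairs s a p : count_mem p (pairs s a) = mult s a p.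
Proof.
rewrite count_map enumT /mult cardsE cardE /enum_mem size_filter.
by apply: eq_count => i; rewrite /= unfold_in.
Qed.

(** A permutation is determined by the relative order of its values: the
    transition from one permutation to another with the same order is increasing,
    and an increasing permutation cannot move any point down. *)
Lemma perm_lt_eq s s' : (forall i j, (s i < s j)%N -> (s' i < s' j)%N) -> s = s'.
Proof.
move=> H.
have ge_id (q : 'S_n) : (forall i j : 'I_n, (i < j)%N -> (q i < q j)%N) ->
      forall i : 'I_n, (i <= q i)%N.
  move=> qH; suff: forall m (i : 'I_n), (i <= m)%N -> (i <= q i)%N.
    by move=> + i => /(_ i i (leqnn i)).
  elim=> [|m IH] i; first by rewrite leqn0 => /eqP ->.
  rewrite leq_eqVlt ltnS => /predU1P [ei|/IH //].
  have lt_m : (m < n)%N by rewrite ltnW // -ei.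
  have := IH (Ordinal lt_m) (leqnn _); have := qH (Ordinal lt_m) i.
  by rewrite /= ei ltnSn => /(_ isT) h1 h2; apply: leq_ltn_trans h2 h1.
have H' i j : (s' i < s' j)%N -> (s i < s j)%N.
  case: (ltngtP (s i) (s j)) => // [/H h1 h2|/val_inj/perm_inj -> ]; last by rewrite ltnn.
  by have := ltn_trans h1 h2; rewrite ltnn.
apply/permP => i; apply/val_inj/eqP; rewrite eqn_leq; apply/andP; split.
- have := ge_id (s^-1 * s')%g _ (s i); rewrite permM permK; apply=> u v lt_uv.
  by rewrite !permM; apply: H; rewrite !permKV.
- have := ge_id (s'^-1 * s)%g _ (s' i); rewrite permM permK; apply=> u v lt_uv.
  by rewrite !permM; apply: H'; rewrite !permKV.
Qed.

(** The list of cells met along the positions is sorted for [pairle], hence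
    determined by its multiplicities; this recovers both a and the word a o s.
    The latter determines the order of the values of the involution s:
    s i < s j iff a (s i) < a (s j), or these letters are equal and i, j are in the
    order prescribed by their prime. *)
Lemma compat_unique s s' a a' :
    involution s -> involution s' -> compat s a -> compat s' a' ->
  mult s a =1 mult s' a' -> s = s' /\ a = a'.
Proof.
move=> /involutionP ss /involutionP ss' ca ca' eqm.
have eqp : pairs s a = pairs s' a'.
  apply: (sorted_eq pairle_trans pairle_anti); try exact: sorted_pairs.
  by apply/allP => p _ /=; rewrite !count_pairs eqm.
have eqi i : (a i, a (s i)) = (a' i, a' (s' i)).
  by move/eq_in_map: eqp => /(_ i); rewrite mem_enum => /(_ isT).
have ea : a = a' by apply/ffunP => i; case: (eqi i).
split=> //; subst a'; have eas i : a (s i) = a (s' i) by case: (eqi i).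
apply: perm_lt_eq => i j lt_s.
(* Compatibility at s i < s j and at s' j < s' i compares the same two letters in
   opposite directions. *)
case: (ltngtP (s' i) (s' j)) => // [lt_s'|/val_inj/perm_inj ei]; last first.
  by move: lt_s; rewrite ei ltnn.
have /compatP/(_ _ _ lt_s) := ca; have /compatP/(_ _ _ lt_s') := ca'.
rewrite /before !ss !ss' -!eas eq_sym.
case: eqP => [->|_]; last by rewrite !orbF; case: ltngtP.
by rewrite ltnn /=; case: (primed _); case: ltngtP.
Qed.

End Compat.

(** * Realizing a matrix by a compatible pair *)

(** Strictly ordered finite sets are initial segments: the rank is the number of
    smaller elements. *)
Lemma ranking (T : finType) (lt : rel T) (n : nat) :
    irreflexive lt -> transitive lt -> (forall u v, u != v -> lt u v || lt v u) ->
    #|T| = n ->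
  exists (rk : T -> 'I_n) (unrk : 'I_n -> T),
    [/\ cancel rk unrk, cancel unrk rk & forall u v, lt u v -> (rk u < rk v)%N].
Proof.
move=> irr trans total <-.
have rk_lt u : (#|[set v | lt v u]| < #|T|)%N.
  rewrite -cardsT; apply/proper_card/properP; split; first exact: subsetT.
  by exists u; rewrite !inE // irr.
pose rk u := Ordinal (rk_lt u).
have rk_mono u v : lt u v -> (rk u < rk v)%N.
  move=> lt_uv; apply/proper_card/properP; split.
    by apply/subsetP => w; rewrite !inE => /trans; apply.
  by exists u; rewrite !inE // irr.
have rk_inj : injective rk.
  move=> u v eq_rk; apply/eqP/negPn/negP => /total.
  by case/orP => /rk_mono; rewrite eq_rk ltnn.
have [unrk rkK unrkK] : bijective rk by apply: inj_card_bij; rewrite ?card_ord.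
by exists rk, unrk.
Qed.

Section Exists.
Variables (A : finType) (key : A -> nat) (key_inj : injective key).
Variable primed : pred A.
Variables (D : nat) (M : A -> A -> nat).
Hypothesis M_lt : forall b c, (M b c < D)%N.
Hypothesis M_sym : forall b c, M b c = M c b.
Hypothesis M_mixed : forall b c, primed b != primed c -> (M b c <= 1)%N.

(** The positions of the pair to be built, before they are numbered: M b c of
    them in each cell (b, c), told apart by an index. *)
Definition point := {p : A * A * 'I_D | (p.2 < M p.1.1 p.1.2)%N}.
Implicit Types u v : point.

Definition point_row u : A := (val u).1.1.
Definition point_col u : A := (val u).1.2.
Definition point_idx u : nat := (val u).2.

Lemma point_idx_lt u : (point_idx u < M (point_row u) (point_col u))%N.
Proof. exact: valP u. Qed.

Lemma point_eq u v :
  point_row u = point_row v -> point_col u = point_col v ->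
  point_idx u = point_idx v -> u = v.
Proof.
move=> er ec ei; apply: val_inj.
case: u v er ec ei => [[[b c] r] Pu] [[[b' c'] r'] Pv].
rewrite /point_row /point_col /point_idx /=.
by move=> -> -> /val_inj ->.
Qed.

(** The order of positions forced by compatibility: by letter, then by the letter
    of the image, forwards or backwards according to the prime.  Inside a cell the
    order is a free choice, made along the index. *)
Definition point_lt u v : bool :=
  (key (point_row u) < key (point_row v))%N || (point_row u == point_row v)
    && ((if primed (point_row u) then key (point_col v) < key (point_col u)
         else key (point_col u) < key (point_col v))%N
        || (point_col u == point_col v) && (point_idx u < point_idx v)%N).

Lemma point_lt_irr : irreflexive point_lt.
Proof. by move=> u; rewrite /point_lt !eqxx !ltnn; case: ifP. Qed.

Lemma point_lt_trans : transitive point_lt.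
Proof.
move=> v u w; rewrite /point_lt.
rewrite -!(inj_eq key_inj).
case: (eqVneq (key (point_row u)) (key (point_row v))) => [/key_inj -> |]; last by lia.
by case: (primed _); lia.
Qed.

Lemma point_lt_total u v : u != v -> point_lt u v || point_lt v u.
Proof.
move=> neq_uv; rewrite /point_lt.
case: (ltngtP (key (point_row u)) (key (point_row v))) => //= [_|/key_inj er];
  rewrite ?orbT // er eqxx /=.
have [ec|nc] := eqVneq (key (point_col u)) (key (point_col v)); last first.
  by case: (primed _); lia.
have /key_inj ec' := ec; rewrite ec' eqxx ltnn /=.
have : point_idx u != point_idx v by apply: contra_neq neq_uv => /(point_eq er ec').
by case: (primed _) => /=; lia.
Qed.

Definition mirror_idx u : nat :=
  if primed (point_row u) then (M (point_row u) (point_col u) - (point_idx u).+1)%N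
  else point_idx u.

Lemma mirror_lt u : (mirror_idx u < M (point_col u) (point_row u))%N.
Proof.
by rewrite M_sym /mirror_idx; have := point_idx_lt u; case: ifP => _; lia.
Qed.

(** The involution, before numbering: exchange the two letters, and reverse the
    index between primed letters.  In a mixed cell the only index is 0, which
    both rules fix, so looking at the prime of one of the letters suffices. *)
Definition mirror u : point :=
  exist _ (point_col u, point_row u, Ordinal (ltn_trans (mirror_lt u) (M_lt _ _)))
    (mirror_lt u).

Lemma point_row_mirror u : point_row (mirror u) = point_col u. Proof. by []. Qed.
Lemma point_col_mirror u : point_col (mirror u) = point_row u. Proof. by []. Qed.
Lemma point_idx_mirror u : point_idx (mirror u) = mirror_idx u.
Proof. by []. Qed.

Lemma mirrorK : involutive mirror.
Proof.
move=> u; apply: point_eq => //; rewrite point_idx_mirror /mirror_idx.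
rewrite point_idx_mirror /mirror_idx point_row_mirror point_col_mirror (M_sym (point_col u)).
have := point_idx_lt u; have := @M_mixed (point_row u) (point_col u).
by case: (primed (point_row u)); case: (primed (point_col u)) => //=; lia.
Qed.

Lemma card_cell b c :
  #|[set u | (point_row u, point_col u) == (b, c)]| = M b c.
Proof.
rewrite -[RHS]card_ord.
have inj : injective (fun r : 'I_(M b c) =>
    exist (fun p : A * A * 'I_D => p.2 < M p.1.1 p.1.2)%N
      (b, c, widen_ord (ltnW (M_lt b c)) r) (ltn_ord r) : point).
  by move=> r r' [] /val_inj.
rewrite -(card_imset _ inj); apply: eq_card => u; rewrite inE.
apply/eqP/imsetP => [[er ec]|[r _ ->] //].
have lt_u := point_idx_lt u; rewrite er ec in lt_u.
by exists (Ordinal lt_u) => //; apply: point_eq.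
Qed.

Lemma card_point : #|{: point}| = (\sum_p M p.1 p.2)%N.
Proof.
rewrite -sum1_card (partition_big (fun u => (point_row u, point_col u)) predT) //=.
apply: eq_bigr => [[b c]] _; rewrite sum1dep_card /= -(card_cell b c).
by apply: eq_card => u; rewrite !inE.
Qed.

(** Number the points along [point_lt] and let [mirror] act on the numbers.  Two
    points with the same unprimed letter keep their order under [mirror], two with
    the same primed letter exchange it; two points of one mixed cell would break
    this, and the bound on mixed entries excludes them. *)
Lemma compat_exists n : (\sum_p M p.1 p.2)%N = n ->
  exists (s : 'S_n) (a : {ffun 'I_n -> A}),
    [/\ involution s, compat key primed s a
      & forall b c, mult s a (b, c) = M b c].
Proof.
rewrite -card_point => En.
have [rk [unrk [rkK unrkK rk_mono]]] :=
  ranking point_lt_irr point_lt_trans point_lt_total En.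
pose f i := rk (mirror (unrk i)).
have fK : involutive f by move=> i; rewrite /f rkK mirrorK unrkK.
pose s : 'S_n := perm (inv_inj fK); pose a := [ffun i => point_row (unrk i)].
exists s, a; split.
- by apply/involutionP => i; rewrite !permE fK.
- apply/compatP => i j lt_ij; rewrite /before !ffunE !permE /f.
  have {lt_ij} : point_lt (unrk i) (unrk j).
    have neq : unrk i != unrk j.
      by apply: contraTneq lt_ij => /(can_inj unrkK) ->; rewrite ltnn.
    case/orP: (point_lt_total neq) => // /rk_mono.
    by rewrite !unrkK => /(ltn_trans lt_ij); rewrite ltnn.
  move: (unrk i) (unrk j) => {i j} u v.
  rewrite {1}/point_lt => /orP [-> //|/andP [/eqP er huv]].
  rewrite er eqxx ltnn /=; rewrite er in huv.
  have Lu := point_idx_lt u; have Lv := point_idx_lt v.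
  have mix := @M_mixed (point_row v) (point_col u).
  rewrite er in Lu.
  case: ifP huv mix => pr huv mix; apply: rk_mono;
    rewrite /point_lt !point_row_mirror !point_col_mirror !point_idx_mirror /mirror_idx
      er !eqxx ltnn !if_same /= pr;
    case/orP: huv => [-> //|/andP [/eqP ec lt_idx]];
    rewrite -?ec in Lv *; rewrite eqxx ltnn /=.
  + by move: mix; case: (primed _) => /=; lia.
  + by move: mix; case: (primed _) => /=; lia.
- move=> b c; rewrite -card_cell /mult -(card_imset _ (can_inj rkK)).
  apply: eq_card => i; rewrite -[i in RHS]unrkK mem_imset ?inE; last exact: can_inj rkK.
  by rewrite !ffunE permE /f rkK.
Qed.

End Exists.

(** * The sum over compatible pairs as a sum over symmetric matrices *)

Definition swap_pair (A : Type) (p : A * A) : A * A := (p.2, p.1).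

Lemma swap_pairK A : involutive (@swap_pair A). Proof. by case. Qed.

Section Shape.
Variables (A : finType) (key : A -> nat) (key_inj : injective key).
Variable primed : pred A.
Variable n : nat.
Implicit Types (s : 'S_n) (a : {ffun 'I_n -> A}) (p : A * A).
Local Notation compat := (compat key primed).

Definition upper p : bool := (key p.1 <= key p.2)%N.

(** A symmetric matrix is read off its upper triangle, where an off-diagonal
    entry stands for two positions per unit, one in each of its letters. *)
Lemma sum_letters (g : A -> nat) s a : involution s ->
  (\sum_i g (a i) = \sum_(p | upper p)
     (g p.1 + (p.1 != p.2) * g p.2) * mult s a p)%N.
Proof.
move=> inv_s.
have -> : (\sum_i g (a i) = \sum_(p : A * A) g p.1 * mult s a p)%N.
  rewrite (partition_big (fun i => (a i, a (s i))) predT) //=.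
  apply: eq_bigr => p _.
  rewrite (eq_bigr (fun=> g p.1)) => [|i /eqP <- //].
  by rewrite sum_nat_const mulnC; congr (_ * _)%N; apply: eq_card => i; rewrite inE.
rewrite (bigID upper) /=.
under [RHS]eq_bigr => p _ do rewrite mulnDl.
rewrite big_split /=; congr (_ + _)%N.
rewrite (reindex_inj (inv_inj (@swap_pairK A))) /=.
rewrite big_mkcond [RHS]big_mkcond; apply: eq_bigr => [[b c] _] /=.
rewrite mult_sym // /upper /= -ltnNge ltn_neqAle (inj_eq key_inj).
by case: (b =P c) => //= _; rewrite ?mul0n ?mul1n //; case: ifP.
Qed.

(** On the positions of a cell s preserves or reverses the order according to the
    prime of the first letter; on their images, which form the transposed cell, it
    does so according to the prime of the second. *)
Lemma mixed_mult s a b c : involution s -> compat s a ->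
  primed b != primed c -> (mult s a (b, c) <= 1)%N.
Proof.
move=> /involutionP ss /compatP ca mix; apply/card_le1_eqP => i j.
have no_two (u v : 'I_n) : (a u, a (s u)) = (b, c) -> (a v, a (s v)) = (b, c) ->
    (u < v)%N -> False.
  move=> [au asu] [av asv] lt_uv; have := ca _ _ lt_uv.
  rewrite /before au av eqxx ltnn /=.
  have h (u' v' : 'I_n) : (s u' < s v')%N -> a (s u') = c -> a (s v') = c ->
      if primed c then (v' < u')%N else (u' < v')%N.
    by move=> /ca; rewrite /before !ss => + e1 e2; rewrite e1 e2 eqxx ltnn.
  move: mix h; case: (primed b); case: (primed c) => //= _ h /h; rewrite asu asv;
    by move=> /(_ erefl erefl); rewrite ltnNge ltnW.
rewrite !inE => /eqP pi /eqP pj.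
by case: (ltngtP i j) => [/no_two|/no_two|/val_inj //] => [/(_ pi pj)|/(_ pj pi)].
Qed.

(** The number of fixed points among the positions of a cell of size m. *)
Definition fix_weight p (m : nat) : nat :=
  if p.1 == p.2 then if primed p.1 then nat_of_bool (odd m) else m else 0%N.

(** An increasing involution is the identity.  A decreasing one has at most one
    fixed point, and any involution of a set has as many fixed points, modulo 2,
    as that set has elements: i |-> s i exchanges the points moved up with those
    moved down. *)
Lemma fix_letter s a b : involution s -> compat s a ->
  #|[set i | (s i == i) && (a i == b)]| =
    if primed b then nat_of_bool (odd (mult s a (b, b))) else mult s a (b, b).
Proof.
move=> /involutionP ss /compatP ca; case: ifP => pb.
- pose S := [set i | (a i, a (s i)) == (b, b)].
  pose F := [set i | (s i == i) && (a i == b)].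
  pose U := [set i in S | (i < s i)%N]; pose V := [set i in S | (s i < i)%N].
  have UV : #|U| = #|V|.
    rewrite -(card_imset _ (@perm_inj _ s)); apply: eq_card => i.
    rewrite -[i in LHS]ss mem_imset ?inE; last exact: perm_inj.
    by rewrite ss !xpair_eqE andbC [in LHS]andbC [(_ == b) && _]andbC andbC.
  have F1 : (#|F| <= 1)%N.
    apply/card_le1_eqP => i j; rewrite !inE => /andP [/eqP si /eqP ai] /andP [/eqP sj /eqP aj].
    by case: (ltngtP i j) => [/[dup] lt_ij|/[dup] lt_ij|/val_inj //];
      move/ca; rewrite /before ai aj eqxx ltnn pb si sj /= ltnNge ltnW.
  have cS : #|S| = (#|F| + (#|U| + #|V|))%N.
    rewrite -!sum1_card (bigID (fun i => s i == i)) /=; congr (_ + _)%N.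
      apply: eq_bigl => i; rewrite !inE xpair_eqE.
      by case: (s i =P i) => [->|]; rewrite ?andbF ?andbT ?andbb.
    rewrite (bigID (fun i : 'I_n => i < s i)%N) /=; congr (_ + _)%N; apply: eq_bigl => i;
      rewrite !inE -andbA; congr (_ && _).
      by rewrite -(inj_eq val_inj) /=; case: ltngtP.
    by rewrite -(inj_eq val_inj) /=; case: ltngtP.
  rewrite -[LHS]/#|F| /mult -/S cS UV addnn oddD odd_double addbF.
  by case: #|F| F1 => [|[]].
- apply: eq_card => i; rewrite !inE xpair_eqE.
  apply/andP/andP => [[/eqP -> ->] //|[/eqP ai /eqP asi]].
  rewrite ai eqxx; split=> //; apply/eqP.
  case: (ltngtP (s i) i) => [/[dup] lt_ij|/[dup] lt_ij|/val_inj //];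
    by move/ca; rewrite /before ai asi eqxx ltnn pb ss /= ltnNge ltnW.
Qed.

Lemma fixpts_mult s a : involution s -> compat s a ->
  fixpts s = (\sum_(p | upper p) fix_weight p (mult s a p))%N.
Proof.
move=> inv_s ca; rewrite /fixpts -sum1_card (partition_big a predT) //=.
rewrite (bigID (fun p => p.1 == p.2)) /= [X in (_ + X)%N]big1 ?addn0; last first.
  by move=> p /andP [_ /negPf np]; rewrite /fix_weight np.
rewrite (reindex_onto (fun b => (b, b)) fst) /=; last first.
  by move=> [b c] /= /andP [_ /eqP ->].
apply: eq_big => [b|b _]; first by rewrite /upper leqnn !eqxx.
by rewrite /fix_weight eqxx -fix_letter // sum1dep_card; apply: eq_card => i; rewrite !inE.
Qed.

(** Entries are bounded in order to range over a finite type; the bound exceeds n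
    and is even, so that it does not cut the pairs of consecutive exponents that
    make up the series of a primed diagonal cell. *)
Definition allowed p : pred 'I_(n.*2).+2 :=
  [pred m : 'I_(n.*2).+2 | (primed p.1 != primed p.2) ==> (m <= 1)%N].

Definition shape s a : {ffun A * A -> 'I_(n.*2).+2} :=
  [ffun p => if upper p then inord (mult s a p) else ord0].

Lemma shapeE s a p : upper p -> shape s a p = mult s a p :> nat.
Proof.
move=> up; rewrite ffunE up inordK // ltnW // !ltnS.
by rewrite (leq_trans (max_card _)) // card_ord -addnn leq_addr.
Qed.

Lemma shape_inj s s' a a' : involution s -> involution s' -> compat s a -> compat s' a' ->
  shape s a = shape s' a' -> s = s' /\ a = a'.
Proof.
move=> inv_s inv_s' ca ca' eqsh; apply: (compat_unique key_inj inv_s inv_s' ca ca').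
have up p : upper p -> mult s a p = mult s' a' p.
  by move=> upp; rewrite -!shapeE // eqsh.
move=> [b c]; case: (leqP (key b) (key c)) => [/(up (_, _)) //|/ltnW/(up (_, _))].
by rewrite mult_sym // [in RHS]mult_sym.
Qed.

Definition pair_size p : nat := (1 + (p.1 != p.2))%N.
Definition prime_weight p : nat := (primed p.1 + (p.1 != p.2) * primed p.2)%N.

Definition shapes : {set {ffun A * A -> 'I_(n.*2).+2}} :=
  [set f in pfamily ord0 upper allowed | (\sum_(p | upper p) pair_size p * f p == n)%N].

Lemma shape_onto :
  (fun sa => shape sa.1 sa.2) @: [set sa : 'S_n * {ffun 'I_n -> A} |
      involution sa.1 && compat sa.1 sa.2] = shapes.
Proof.
apply/setP => f; apply/imsetP/idP => [[[s a]]|].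
  rewrite inE /= => /andP [inv_s ca] ->; rewrite inE; apply/andP; split.
    apply/pfamilyP; split=> [|p up].
      by apply/supportP => p np; rewrite ffunE [upper p](negPf np).
    rewrite inE; apply/implyP => mix; rewrite shapeE //.
    by case: p up mix => b c _; apply: mixed_mult.
  apply/eqP; rewrite -[RHS]card_ord -sum1_card (sum_letters (fun=> 1%N) a inv_s).
  by apply: eq_bigr => p up; rewrite muln1 shapeE.
rewrite inE => /andP [/pfamilyP [/supportP f0 fQ] /eqP fn].
pose M b c : nat := if upper (b, c) then f (b, c) else f (c, b).
have M_sym b c : M b c = M c b.
  by rewrite /M /upper /=; case: ltngtP => // /key_inj ->.
have M_mixed b c : primed b != primed c -> (M b c <= 1)%N.
  rewrite /M; case: ifP => up mix.
    by have := fQ _ up; rewrite inE => /implyP; apply.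
  have up' : upper (c, b) by rewrite /upper ltnW // ltnNge; apply: negbT.
  by have := fQ _ up'; rewrite inE => /implyP; apply; rewrite eq_sym.
have M_lt b c : (M b c < (n.*2).+2)%N by rewrite /M; case: ifP.
have Mn : (\sum_p M p.1 p.2)%N = n.
  rewrite -[RHS]fn (bigID upper) /=.
  under [RHS]eq_bigr => p _ do rewrite mulnDl mul1n.
  rewrite big_split /=; congr (_ + _)%N.
    by apply: eq_bigr => [[b c]] up; rewrite /M up.
  rewrite (reindex_inj (inv_inj (@swap_pairK A))) /=.
  rewrite big_mkcond [RHS]big_mkcond; apply: eq_bigr => [[b c] _] /=.
  rewrite /M /upper /= -ltnNge ltn_neqAle (inj_eq key_inj).
  case: (b =P c) => [->|ne] /=; first by rewrite mul0n if_same.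
  rewrite mul1n; case: ifP => // le_bc; case: ifP => // le_cb; case: ne.
  by apply: key_inj; apply/eqP; rewrite eqn_leq le_bc.
have [s [a [inv_s ca Ms]]] := compat_exists key_inj M_lt M_sym M_mixed Mn.
exists (s, a); first by rewrite inE inv_s.
apply/ffunP => p; apply/val_inj; have [up|np] := boolP (upper p).
  by rewrite /= shapeE //; case: p up => b c up; rewrite Ms /M up.
by rewrite /= ffunE (negPf np) (f0 _ np).
Qed.

Lemma sum_compat (R : comNzRingType) (y z : R) :
  \sum_(s : 'S_n | involution s) \sum_(a | compat s a)
     z ^+ fixpts s * y ^+ (\sum_i primed (a i))%N
  = \sum_(f in shapes) \prod_(p | upper p)
      (z ^+ fix_weight p (f p) * y ^+ (prime_weight p * f p)).
Proof.
rewrite pair_big_dep /= -shape_onto big_imset /=; last first.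
  move=> [s a] [s' a']; rewrite !inE /= => /andP [i1 c1] /andP [i2 c2].
  by move/(shape_inj i1 i2 c1 c2) => [-> ->].
apply: eq_big => [[s a]|[s a] /= /andP [inv_s ca]]; first by rewrite inE.
rewrite (fixpts_mult inv_s ca) (sum_letters (fun b => primed b : nat) a inv_s).
rewrite -!prodrXr -big_split /=; apply: eq_bigr => p up.
by rewrite shapeE.
Qed.

End Shape.

(** * The product of the cell series *)

Lemma sum_double (V : nmodType) (F : nat -> V) m :
  \sum_(i < m.*2) F i = \sum_(i < m) (F i.*2 + F i.*2.+1).
Proof.
elim: m => [|m IH]; first by rewrite !big_ord0.
by rewrite doubleS !big_ord_recr /= IH addrA.
Qed.

Section Series.
Variable R : comNzRingType.
Implicit Types (f g : {fps R}) (c : R).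

Lemma fcoef_sum (I : Type) (r : seq I) (P : pred I) (F : I -> {fps R}) n :
  fcoef (\sum_(i <- r | P i) F i) n = \sum_(i <- r | P i) fcoef (F i) n.
Proof.
exact: (big_morph (fun f : {fps R} => fcoef f n) (fun f g => fcoefD f g n) (fcoef0 R n)).
Qed.

Lemma fcoefXn (k n : nat) : fcoef (fpsX ^+ k : {fps R}) n = (n == k)%:R.
Proof.
rewrite -[fpsX ^+ k]mul1r fcoefMXn fcoef1 subn_eq0.
by case: ltngtP.
Qed.

Definition agree n f g := forall i, (i <= n)%N -> fcoef f i = fcoef g i.

Lemma agreeM n f f' g g' : agree n f f' -> agree n g g' -> agree n (f * g) (f' * g').
Proof.
move=> ff gg i le_in; rewrite !fcoefM; apply: eq_bigr => j _.
by rewrite ff ?gg ?(leq_trans _ le_in) ?leq_subr // -ltnS.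
Qed.

Lemma agree_prod n (I : Type) (r : seq I) (P : pred I) (F G : I -> {fps R}) :
  (forall i, P i -> agree n (F i) (G i)) ->
  agree n (\prod_(i <- r | P i) F i) (\prod_(i <- r | P i) G i).
Proof. by move=> FG; apply: big_ind2 => //; apply: agreeM. Qed.

End Series.

Section Inverse.
Variable R : comUnitRingType.

Lemma fps_unit_1BMXn (c : R) d : (0 < d)%N -> 1 - fpsC c * fpsX ^+ d \is a GRing.unit.
Proof.
case: d => // d _.
by rewrite fps_unitE fcoefD fcoefN fcoefCM fcoefXn fcoef1 /= mulr0 subr0 unitr1.
Qed.

(** The truncated geometric series S satisfies (1 - u) S = 1 - u^D, and u^D has no
    term of degree at most n. *)
Lemma agree_geometric n D d (c : R) : (n < d * D)%N ->
  agree n (1 - fpsC c * fpsX ^+ d)^-1 (\sum_(m < D) fpsC (c ^+ m) * fpsX ^+ (d * m)).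
Proof.
move=> lt_n.
have U : 1 - fpsC c * fpsX ^+ d \is a GRing.unit.
  by apply: fps_unit_1BMXn; case: d lt_n.
have -> : \sum_(m < D) fpsC (c ^+ m) * fpsX ^+ (d * m)
    = (1 - fpsC c * fpsX ^+ d)^-1 * (1 - fpsC (c ^+ D) * fpsX ^+ (d * D)).
  apply: (mulrI U); rewrite mulVKr // rmorphXn exprM -exprMn.
  rewrite -[RHS]opprB subrX1 -[RHS]mulNr opprB; congr (_ * _).
  by apply: eq_bigr => i _; rewrite rmorphXn exprM exprMn.
rewrite -{1}[_^-1]mulr1; apply: agreeM => // i le_in.
by rewrite fcoefD fcoefN fcoefCM fcoefXn ltn_eqF ?mulr0 ?subr0 // (leq_ltn_trans le_in).
Qed.

Section Shapes.
Variables (A : finType) (key : A -> nat) (key_inj : injective key).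
Variable primed : pred A.
Variables y z : R.

(** The generating series of the possible entries of an upper cell, weighted by
    the positions, the primed letters and the fixed points they bring. *)
Definition cell_series (p : A * A) : {fps R} :=
  if p.1 == p.2 then
    if primed p.1 then (1 + fpsC (z * y) * fpsX) / (1 - fpsC (y ^+ 2) * fpsX ^+ 2)
    else (1 - fpsC z * fpsX)^-1
  else if primed p.1 != primed p.2 then 1 + fpsC y * fpsX ^+ 2
  else if primed p.1 then (1 - fpsC (y ^+ 2) * fpsX ^+ 2)^-1
  else (1 - fpsX ^+ 2)^-1.

(** In a primed diagonal cell the even size 2j and the odd size 2j+1 combine into
    (yx)^(2j) (1 + zyx), whence the numerator. *)
Lemma agree_cell n p : agree n (cell_series p)
  (\sum_(m < (n.*2).+2 | allowed primed p m)
     fpsC (z ^+ fix_weight primed p m * y ^+ (prime_weight primed p * m))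
       * fpsX ^+ (pair_size p * m)).
Proof.
case: p => b c; rewrite /cell_series /allowed /fix_weight /prime_weight /pair_size /=.
case: (b =P c) => [->|_] /=.
  rewrite eqxx /=; case: (primed c) => /=.
    have -> : \sum_(m < (n.*2).+2)
          fpsC (z ^+ odd m * y ^+ ((1 + 0 * true) * m)) * fpsX ^+ ((1 + 0) * m)
        = (1 + fpsC (z * y) * fpsX)
          * \sum_(m < n.+1) fpsC ((y ^+ 2) ^+ m) * fpsX ^+ (2 * m) :> {fps R}.
      rewrite (sum_double (fun m => fpsC (z ^+ odd m * y ^+ ((1 + 0 * true) * m))
         * fpsX ^+ ((1 + 0) * m)) n.+1) mulr_sumr.
      apply: eq_bigr => i _; rewrite oddS odd_double !mul1n -mul2n expr0 mul1r mulrDl mul1r.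
      rewrite -exprM [z ^+ _]expr1 [y ^+ (2 * i).+1]exprS [fpsX ^+ (2 * i).+1]exprS.
      rewrite [z * (y * _)]mulrA [fpsC (z * y * _)]rmorphM -!mulrA.
      by rewrite [fpsX * (fpsC _ * _)]mulrCA.
    by apply: agreeM => //; apply: agree_geometric; lia.
  rewrite -[fpsX]expr1.
  have := @agree_geometric n (n.*2).+2 1 z; rewrite expr1 => H i le_in.
  rewrite H //; last by lia.
  by congr fcoef; apply: eq_bigr => m _; rewrite mulr1.
case: eqP => [->|/eqP mix] /=.
  case: (primed c); rewrite /= ?mul1n ?addn0 => i le_in.
    rewrite (@agree_geometric n (n.*2).+2 2 (y ^+ 2)) //; last by lia.
    by congr fcoef; apply: eq_bigr => m _; rewrite mul1r -exprM.
  have -> : fpsX ^+ 2 = fpsC 1 * fpsX ^+ 2 :> {fps R} by rewrite rmorph1 mul1r.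
  rewrite (@agree_geometric n (n.*2).+2 2 1) //; last by lia.
  by congr fcoef; apply: eq_bigr => m _; rewrite mul1r expr1n.
rewrite big_mkcond !big_ord_recl /= big1 // addr0.
rewrite (_ : bump 0 0 = 1%N) // !muln0 !muln1 mul1n !expr0 !mul1r.
by case: (primed b) mix; case: (primed c).
Qed.

(** Expanding the product of the truncated cell series chooses an entry in every
    upper cell, that is, a symmetric matrix. *)
Lemma coef_prod_cell n :
  fcoef (\prod_(p | upper key p) cell_series p) n
  = \sum_(s : 'S_n | involution s) \sum_(a : {ffun 'I_n -> A} | compat key primed s a)
      z ^+ fixpts s * y ^+ (\sum_i primed (a i))%N.
Proof.
rewrite (sum_compat key_inj) (agree_prod _ (fun p _ => @agree_cell n p)) //.
rewrite (big_distr_big_dep ord0) fcoef_sum /shapes.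
rewrite [RHS](eq_bigl (fun f => (f \in pfamily ord0 (upper key) (@allowed _ primed n))
    && (\sum_(p | upper key p) pair_size p * f p == n)%N)); last by move=> f; rewrite inE.
rewrite big_mkcondr; apply: eq_bigr => f _.
rewrite big_split -rmorph_prod prodrXr fcoefCM fcoefXn eq_sym.
by case: eqP; rewrite ?mulr1 ?mulr0.
Qed.

End Shapes.
End Inverse.

(** * The alphabet of k primed and k unprimed letters *)

(** The boolean tells whether the letter is primed. *)
Notation letter k := ('I_k * bool)%type.

Definition letter_key k (b : letter k) : nat := (b.1.*2 + ~~ b.2)%N.

Lemma letter_key_inj k : injective (@letter_key k).
Proof.
move=> [c e] [c' e']; rewrite /letter_key /= => eq_key.
suff [/val_inj -> ->] : c = c' :> nat /\ e = e' by [].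
by case: e e' eq_key => [] [] /=; lia.
Qed.

Lemma prod_ltn (S : comNzRingType) (v : S) k :
  \prod_(i < k) \prod_(j < k | (i < j)%N) v = v ^+ 'C(k, 2).
Proof.
rewrite (exchange_big_dep predT) //= -bin2_sum big_mkord -prodrXr; apply: eq_bigr => j _.
by rewrite -(big_ord_widen _ (fun=> v)) ?prodr_const ?card_ord // ltnW.
Qed.

Lemma prod_leq (S : comNzRingType) (v : S) k :
  \prod_(i < k) \prod_(j < k | (i <= j)%N) v = v ^+ 'C(k.+1, 2).
Proof.
rewrite binS bin1 exprD -prod_ltn -[X in _ * v ^+ X](card_ord k) -prodr_const -big_split.
apply: eq_bigr => i _; rewrite [LHS](bigD1 i) //= mulrC; congr (_ * _).
by apply: eq_bigl => j; rewrite ltn_neqAle eq_sym andbC.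
Qed.

Section Letters.
Variables (R : comUnitRingType) (y z : R).

Definition level_num k : {fps R} :=
  (1 + fpsC (z * y) * fpsX) ^+ k * (1 + fpsC y * fpsX ^+ 2) ^+ (k ^ 2).

Definition level_den k : {fps R} :=
  (1 - fpsC z * fpsX) ^+ k * (1 - fpsX ^+ 2) ^+ 'C(k, 2)
  * (1 - fpsC (y ^+ 2) * fpsX ^+ 2) ^+ 'C(k.+1, 2).

Definition level_series k : {fps R} := level_num k / level_den k.

(** For numbers i < j each of the four pairs of a letter i and a letter j is upper,
    and two of them are mixed; for i = j only the mixed pair i' < i is off the
    diagonal.  So X, the mixed factor, occurs once for i < j and once for i <= j,
    that is, k^2 times in all. *)
Lemma prod_cell_letters k :
  \prod_(p : letter k * letter k | upper (@letter_key k) p) cell_series snd y z p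
  = level_series k.
Proof.
rewrite /level_series /level_num /level_den.
set P := 1 + fpsC (z * y) * fpsX; set X := 1 + fpsC y * fpsX ^+ 2.
set U1 := 1 - fpsC z * fpsX; set U := 1 - fpsX ^+ 2.
set V := 1 - fpsC (y ^+ 2) * fpsX ^+ 2.
have UU1 : U1 \is a GRing.unit by have := @fps_unit_1BMXn R z 1 isT; rewrite expr1.
have UU : U \is a GRing.unit.
  by have := @fps_unit_1BMXn R 1 2 isT; rewrite rmorph1 mul1r.
have UV : V \is a GRing.unit by apply: fps_unit_1BMXn.
rewrite (bigID (fun p => p.1 == p.2)) /=.
have -> : \prod_(p : letter k * letter k | upper (@letter_key k) p && (p.1 == p.2))
    cell_series snd y z p = (P / V) ^+ k * U1^-1 ^+ k.
  rewrite (reindex_onto (fun b => (b, b)) fst) /=; last first.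
    by move=> [b c] /= /andP [_ /eqP ->].
  rewrite (eq_bigl predT) => [|b]; last by rewrite /upper leqnn !eqxx.
  rewrite -(pair_bigA _ (fun c e => cell_series snd y z ((c, e), (c, e)))) /=.
  under eq_bigr => c _ do rewrite big_bool /cell_series /= !eqxx.
  by rewrite prodr_const card_ord exprMn.
have -> : \prod_(p : letter k * letter k | upper (@letter_key k) p && (p.1 != p.2))
    cell_series snd y z p
  = (\prod_(i < k) \prod_(j < k | (i < j)%N) (U^-1 * V^-1 * X))
    * (\prod_(i < k) \prod_(j < k | (i <= j)%N) X).
  rewrite -(pair_big_dep predT (fun b c => upper (@letter_key k) (b, c) && (b != c))
    (fun b c => cell_series snd y z (b, c))) /=.
  rewrite -(pair_bigA _ (fun i e => \prod_(c | upper (@letter_key k) ((i, e), c)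
     && ((i, e) != c)) cell_series snd y z ((i, e), c))) /=.
  rewrite -big_split /=; apply: eq_bigr => i _.
  have E e : \prod_(c | upper (@letter_key k) ((i, e), c) && ((i, e) != c))
      cell_series snd y z ((i, e), c) = \prod_(j : 'I_k) \prod_(f : bool)
        if (i.*2 + ~~ e < j.*2 + ~~ f)%N then
          (if e != f then X else if e then V^-1 else U^-1) else 1.
    rewrite big_mkcond.
    rewrite (pair_bigA _ (fun (j : 'I_k) f => if (i.*2 + ~~ e < j.*2 + ~~ f)%N then
          (if e != f then X else if e then V^-1 else U^-1) else 1)) /=.
    apply: eq_bigr => [[j f]] _ /=.
    rewrite -(inj_eq (@letter_key_inj k)) /upper /= andbC -ltn_neqAle /letter_key /=.
    case: ifP => // lt_ef; rewrite /cell_series /= ifF //.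
    by apply: contraTF lt_ef => /eqP [-> ->]; rewrite ltnn.
  rewrite big_bool /= !E -big_split [X in _ = X * _]big_mkcond [X in _ = _ * X]big_mkcond.
  rewrite -big_split; apply: eq_bigr => j _.
  have L e f : (i.*2 + ~~ e < j.*2 + ~~ f)%N = if e && ~~ f then (i <= j)%N else (i < j)%N.
    by case: e f => [] [] /=; lia.
  rewrite !big_bool !L /=.
  case: ltngtP => _ /=; ring.
rewrite prod_ltn prod_leq.
rewrite !exprMn !exprVn !invrM ?unitrX ?unitrM ?unitrX //.
have -> : X ^+ (k ^ 2) = X ^+ 'C(k, 2) * X ^+ 'C(k.+1, 2).
  rewrite -exprD; congr (_ ^+ _); rewrite binS bin1 addnA addnn -mul2n mul_bin_left.
  by rewrite bin1; case: k => // k; rewrite subSS subn0; lia.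
have -> : V ^- 'C(k.+1, 2) = V ^- k * V ^- 'C(k, 2).
  by rewrite binS bin1 exprD invrM ?unitrX.
ring.
Qed.

Lemma fcoef0X (f : {fps R}) m : fcoef f 0 = 1 -> fcoef (f ^+ m) 0 = 1.
Proof. by move=> f1; elim: m => // m IH; rewrite exprS fcoefM0 f1 IH mulr1. Qed.

Lemma level_den0 k : fcoef (level_den k) 0 = 1.
Proof.
rewrite /level_den !fcoefM0 !fcoef0X ?mulr1 //;
  by rewrite fcoefD fcoefN ?fcoefCM ?fcoefXn fcoef1 /= ?mulr0 subr0.
Qed.

Lemma level_den_unit k : level_den k \is a GRing.unit.
Proof. by rewrite fps_unitE level_den0 unitr1. Qed.

Lemma level_series0 k : fcoef (level_series k) 0 = 1.
Proof.
have : fcoef (level_series k * level_den k) 0 = 1.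
  rewrite /level_series divrK ?level_den_unit // fcoefM0 !fcoef0X ?mulr1 //;
    by rewrite fcoefD fcoefCM ?fcoefXn fcoef1 /= mulr0 addr0.
by rewrite fcoefM0 level_den0 mulr1.
Qed.

End Letters.

(** * Counting words with prescribed strict steps *)

Section FfunRcons.
Variables (T : finType) (l : nat).

Definition ffun_rcons (a : {ffun 'I_l -> T}) (x : T) : {ffun 'I_l.+1 -> T} :=
  [ffun i => if unlift ord_max i is Some j then a j else x].

Lemma ffun_rcons_lift a x j : ffun_rcons a x (lift ord_max j) = a j.
Proof. by rewrite ffunE liftK. Qed.

Lemma ffun_rcons_max a x : ffun_rcons a x ord_max = x.
Proof. by rewrite ffunE unlift_none. Qed.

Lemma forall_ord_recr (P : pred 'I_l.+1) :
  [forall i, P i] = [forall i, P (lift ord_max i)] && P ord_max.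
Proof.
apply/forallP/andP => [H|[/forallP H Hm] i]; first by split=> //; apply/forallP.
by case: (unliftP ord_max i) => [j ->|->].
Qed.

Lemma sum_ffun_recr (V : nmodType) (F : {ffun 'I_l.+1 -> T} -> V) :
  \sum_a F a = \sum_x \sum_a F (ffun_rcons a x).
Proof.
rewrite pair_big /= (reindex (fun p => ffun_rcons p.2 p.1)) //=.
exists (fun a => (a ord_max, [ffun i => a (lift ord_max i)])) => [[x a] _|a _] /=.
  by rewrite ffun_rcons_max; congr pair; apply/ffunP => i; rewrite ffunE ffun_rcons_lift.
by apply/ffunP => i; rewrite ffunE; case: unliftP => [j ->|->]; rewrite ?ffunE.
Qed.

End FfunRcons.

(** In this section [la] and [rd] prescribe which positions have an ascent on their
    left and a descent on their right; [pre] and [post] say whether a letter at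
    position j forces a strict step before, or after, itself. *)
Section GapCount.
Variables (la rd : nat -> bool) (R : comNzRingType) (y : R).
Hypothesis la0 : la 0 = false.

Definition pre (j : nat) (e : bool) : bool := la j && e.
Definition post (j : nat) (e : bool) : bool := rd j && ~~ e.

Section Words.
Variable K : nat.

Definition gaps l (a : {ffun 'I_l -> letter K}) : bool :=
  [forall i : 'I_l, forall j : 'I_l,
     (i < j)%N ==> ((a i).1 + post i (a i).2 + pre j (a j).2 <= (a j).1)%N].

(** Numbers stay below k, and below k - 1 for a letter that forces a strict step
    after itself, as if k were the next number.  The clause 0 < k makes the empty
    word behave like a letter 0 followed by a weak step. *)
Definition below k l (a : {ffun 'I_l -> letter K}) : bool :=
  (0 < k)%N && [forall i : 'I_l, (a i).1 + post i (a i).2 < k]%N.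

Lemma gaps_rcons l (a : {ffun 'I_l -> letter K}) (x : letter K) :
  gaps (ffun_rcons a x) =
  gaps a && [forall i, ((a i).1 + post i (a i).2 + pre l x.2 <= x.1)%N].
Proof.
rewrite /gaps forall_ord_recr [X in _ && X](_ : _ = true) ?andbT; last first.
  by apply/forallP => j; rewrite [(_ < j)%N]ltnNge -ltnS ltn_ord.
apply/forallP/andP => [H|[/forallP H1 /forallP H2] i].
  split; apply/forallP => i; have := H i; rewrite forall_ord_recr => /andP [/forallP H1].
    by move=> _; apply/forallP => j; have := H1 j; rewrite !ffun_rcons_lift !lift_max.
  by rewrite ffun_rcons_lift ffun_rcons_max lift_max ltn_ord.
rewrite forall_ord_recr ffun_rcons_lift ffun_rcons_max lift_max H2 implybT andbT.
by apply/forallP => j; have /forallP/(_ j) := H1 i; rewrite ffun_rcons_lift !lift_max.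
Qed.

(** Adding a last letter of number c turns the bound k into c + 1, or c if the new
    letter forces a strict step before itself.  The latter cannot happen to the
    first letter of a word, which is where [la 0 = false] enters. *)
Lemma below_rcons k l (a : {ffun 'I_l -> letter K}) (x : letter K) :
  gaps (ffun_rcons a x) && below k (ffun_rcons a x)
  = (x.1 + post l x.2 < k)%N && (gaps a && below (x.1.+1 - pre l x.2)%N a).
Proof.
rewrite gaps_rcons /below forall_ord_recr ffun_rcons_max.
case: (gaps a); rewrite ?andbF // !andTb.
apply/idP/idP.
  case/and4P => /forallP H1 k0 _ -> /=; apply/andP; split=> //=.
    case: l a H1 => [|l] a H1; first by rewrite /pre la0.
    by have := H1 ord0; case: (pre _ _) => /=; lia.
  by apply/forallP => i; have := H1 i; lia.
case/and3P => lt_x _ /forallP H1; apply/and4P; split=> //.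
- by apply/forallP => i; have := H1 i; lia.
- by apply: leq_ltn_trans lt_x.
- apply/forallP => i; rewrite ffun_rcons_lift lift_max (leq_trans (H1 i)) //.
  by apply: leq_trans (leq_subr _ _) (leq_ltn_trans (leq_addr _ _) lt_x).
Qed.

Lemma primes_rcons l (a : {ffun 'I_l -> letter K}) (x : letter K) :
  (\sum_i (ffun_rcons a x i).2 = x.2 + \sum_i (a i).2)%N.
Proof.
rewrite big_ord_recr /= ffun_rcons_max addnC; congr (_ + _)%N.
apply: eq_bigr => i _; rewrite (_ : widen_ord _ i = lift ord_max i) ?ffun_rcons_lift //.
by apply/val_inj; rewrite [RHS]lift_max.
Qed.

End Words.

(** The weighted number of words of length l below k, by recursion on the last
    letter. *)
Fixpoint gapcount (l k : nat) : R :=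
  if l is l'.+1 then
    \sum_(e : bool) y ^+ e *
      \sum_(x < k | (x + post l' e < k)%N) gapcount l' (x.+1 - pre l' e)
  else (0 < k)%N%:R.

(** The numbers range over ['I_K] with K fixed, so that the recursion lowers the
    bound k and not the type of the words. *)
Lemma sum_gaps K l k : (k <= K)%N ->
  \sum_(a : {ffun 'I_l -> letter K} | gaps a && below k a) y ^+ (\sum_i (a i).2)%N
  = gapcount l k.
Proof.
elim: l k => [|l IH] k le_kK /=.
  pose a0 : {ffun 'I_0 -> letter K} :=
    finfun (fun i : 'I_0 => False_rect _ (notF (ltn_ord i))).
  rewrite big_mkcond (big_pred1 a0) => [|a]; last by apply/esym/eqP/ffunP => -[].
  rewrite /gaps /below big_ord0 /=.
  have allT (P : pred 'I_0) : [forall i, P i] by apply/forallP => -[].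
  by rewrite !allT andbT /=; case: (0 < k)%N.
rewrite big_mkcond sum_ffun_recr.
transitivity (\sum_(c < K) \sum_(e : bool) \sum_(a : {ffun 'I_l -> letter K})
    if gaps (ffun_rcons a (c, e)) && below k (ffun_rcons a (c, e))
    then y ^+ (\sum_i (ffun_rcons a (c, e) i).2)%N else 0).
  by rewrite [RHS]pair_bigA; apply: eq_bigr => [[c e]] _.
rewrite exchange_big /=.
apply: eq_bigr => e _; rewrite (big_ord_widen_cond K (fun x => x + post l e < k)%N
  (fun x => gapcount l (x.+1 - pre l e))) // mulr_sumr big_mkcond.
rewrite [RHS]big_mkcond; apply: eq_bigr => x _ /=.
under eq_bigr => a _ do rewrite below_rcons primes_rcons /=.
case: ltnP => lt_x /=; last by rewrite big1 ?andbF.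
rewrite (leq_ltn_trans _ lt_x) ?leq_addr //= -IH; last first.
  by rewrite (leq_trans (leq_subr _ _)).
rewrite -big_mkcond mulr_sumr; apply: eq_bigr => a _.
by rewrite exprD.
Qed.

Lemma gapcount0 l : gapcount l 0 = 0.
Proof. by case: l => [|l] //=; rewrite big1 // => e _; rewrite big_ord0 mulr0. Qed.

(** The increment in k of the inner sum of [gapcount]: only the largest number
    allowed to the last letter is new. *)
Lemma gapcount_shift l k r p : (r + p <= 1)%N ->
  \sum_(x < k.+1 | (x + r < k.+1)%N) gapcount l (x.+1 - p)
  = \sum_(x < k | (x + r < k)%N) gapcount l (x.+1 - p)
    + fcoef (fpsX ^+ (r + p) * FPS (gapcount l)) k.+1.
Proof.
move=> rp; rewrite mulrC fcoefMXn /=.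
case: r p rp => [|[|r]] [|[|p]] //= _.
- under eq_bigl => x do rewrite addn0 ltn_ord.
  under [X in _ = X + _]eq_bigl => x do rewrite addn0 ltn_ord.
  by rewrite big_ord_recr.
- under eq_bigl => x do rewrite addn0 ltn_ord.
  under [X in _ = X + _]eq_bigl => x do rewrite addn0 ltn_ord.
  by rewrite big_ord_recr.
- under eq_bigl => x do rewrite addn1 ltnS.
  under [X in _ = X + _]eq_bigl => x do rewrite addn1.
  rewrite -(big_ord_widen _ (fun x => gapcount l (x.+1 - 0))) //.
  case: k => [|k]; first by rewrite !big_ord0 /= gapcount0 addr0.
  under [X in _ = X + _]eq_bigl => x do rewrite ltnS.
  by rewrite -(big_ord_widen _ (fun x => gapcount l (x.+1 - 0))) // big_ord_recr /=
    subn0 subn1.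
Qed.

(** Multiplying by 1 - t takes differences in k. *)
Lemma gapcount_series_rec l :
  FPS (gapcount l.+1) * (1 - fpsX)
  = (fpsC y * fpsX ^+ la l + fpsX ^+ rd l) * FPS (gapcount l).
Proof.
apply/fpsP => k; rewrite mulrBr mulr1 fcoefD fcoefN fcoefMX mulrDl fcoefD -mulrA.
rewrite fcoefCM; case: k => [|k].
  rewrite !fcoefM0 -![fcoef (FPS _) 0]/(gapcount _ 0) !gapcount0 !mulr0 addr0.
  by rewrite subr0.
rewrite [fcoef (FPS _) k.+1]/= [fcoef (FPS _) _]/= !big_bool.
rewrite !gapcount_shift /pre /post ?andbF ?andbT ?addn0 ?add0n;
  try by case: (la l); case: (rd l).
rewrite [y ^+ true]expr1 [y ^+ false]expr0 /=; ring.
Qed.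

Lemma gapcount_series l :
  FPS (gapcount l) * (1 - fpsX) ^+ l.+1
  = fpsX * \prod_(j < l) (fpsC y * fpsX ^+ la j + fpsX ^+ rd j).
Proof.
elim: l => [|l IH].
  rewrite big_ord0 mulr1 expr1; apply/fpsP => k; rewrite mulrBr mulr1 fcoefD fcoefN fcoefMX /=.
  by case: k => [|[|k]] /=; rewrite ?subr0 ?subrr.
rewrite exprS mulrA gapcount_series_rec -mulrA IH big_ord_recr /=.
ring.
Qed.

End GapCount.

(** * Descents and peaks *)

Lemma consecutiveP n (r : rel 'I_n) : transitive r ->
  (forall i j : 'I_n, (i < j)%N -> r i j)
  <-> (forall i j : 'I_n, j = i.+1 :> nat -> r i j).
Proof.
move=> r_trans; split=> [H i j e|H i j lt_ij]; first by apply: H; rewrite e.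
have [d ed] : exists d, j = (i + d).+1 :> nat by exists (j - i.+1)%N; lia.
elim: d j {lt_ij} ed => [|d IH] j ed; first by apply: H; rewrite ed addn0.
have lt_n : (i + d < n.-1)%N by have := ltn_ord j; lia.
have lt_n' : ((i + d).+1 < n)%N by lia.
by apply: (r_trans (Ordinal lt_n')); [apply: IH|apply: H; rewrite ed addnS].
Qed.

Section PermStats.
Variables (n : nat) (s : 'S_n).

(** The values of s as a function on all of nat, 0 outside the range: neighbours
    of a position are then plain arithmetic. *)
Definition value (m : nat) : nat := if insub m is Some i then s i : nat else 0%N.

Lemma valueE (i : 'I_n) : value i = s i.
Proof. by rewrite /value valK. Qed.

Definition asc_left (m : nat) : bool := [&& 0 < m, m < n & value m.-1 < value m]%N.
Definition desc_right (m : nat) : bool := (m.+1 < n)%N && (value m.+1 < value m)%N.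

Lemma asc_left_succ (i j : 'I_n) : j = i.+1 :> nat -> asc_left j = (s i < s j)%N.
Proof. by move=> e; rewrite /asc_left ltn_ord e /= -e !valueE. Qed.

Lemma desc_right_succ (i j : 'I_n) : j = i.+1 :> nat -> desc_right i = (s j < s i)%N.
Proof. by move=> e; rewrite /desc_right -e ltn_ord !valueE. Qed.

Lemma before_trans k (a : {ffun 'I_n -> letter k}) :
  transitive (before (@letter_key k) snd s a).
Proof.
move=> j i l; rewrite /before.
case/orP=> [lt1|/andP[/eqP e1 h1]]; case/orP=> [lt2|/andP[/eqP e2 h2]].
- by rewrite (ltn_trans lt1 lt2).
- by rewrite -e2 lt1.
- by rewrite e1 lt2.
- rewrite e1 -e2 eqxx orbC /=; rewrite e1 in h1; move: h1 h2.
  by case: ((a j).2) => h1 h2; rewrite (ltn_trans _ h1, ltn_trans h1).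
Qed.

Definition gap k (a : {ffun 'I_n -> letter k}) (i j : 'I_n) : bool :=
  ((a i).1 + post desc_right i (a i).2 + pre asc_left j (a j).2 <= (a j).1)%N.

Lemma gap_trans k (a : {ffun 'I_n -> letter k}) : transitive (gap a).
Proof. by move=> j i l; rewrite /gap; lia. Qed.

(** Four cases for the primes.  On an ascent a repeated letter is allowed when
    unprimed, and c' c is a rise within one number: only a primed letter on the
    right forces a larger number.  Descents are symmetric. *)
Lemma before_gap k (a : {ffun 'I_n -> letter k}) (i j : 'I_n) :
  j = i.+1 :> nat -> before (@letter_key k) snd s a i j = gap a i j.
Proof.
move=> e; rewrite /before /gap /pre /post (asc_left_succ e) (desc_right_succ e).
rewrite -(inj_eq (@letter_key_inj k)) /letter_key.
have : s i != s j by rewrite (inj_eq perm_inj) -(inj_eq val_inj) /= e neq_ltn ltnSn.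
rewrite -(inj_eq val_inj) /= neq_ltn.
case: (a i) (a j) => [ci ei] [cj ej] /=.
by case: ltngtP => //= _ _; case: ei; case: ej => /=; lia.
Qed.

(** Both relations are transitive, so it is enough to compare them at adjacent
    positions. *)
Lemma compat_gaps k (a : {ffun 'I_n -> letter k}) :
  compat (@letter_key k) snd s a = gaps asc_left desc_right a.
Proof.
apply/compatP/idP => [ca|ga].
  apply/forallP => i; apply/forallP => j; apply/implyP; move: i j.
  apply/(consecutiveP (@gap_trans k a)) => i j e; rewrite -before_gap //.
  by apply: ca; rewrite e.
apply/(consecutiveP (@before_trans k a)) => i j e; rewrite before_gap //.
by have /forallP/(_ i)/forallP/(_ j)/implyP := ga; apply; rewrite e.
Qed.

Lemma gaps_below k (a : {ffun 'I_n -> letter k}) : (0 < n)%N ->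
  gaps asc_left desc_right a -> below desc_right k a.
Proof.
move=> n_gt0 ga; rewrite /below.
have -> : (0 < k)%N by have := ltn_ord (a (Ordinal n_gt0)).1; lia.
apply/forallP => i; rewrite /post; case: (boolP (desc_right i)) => [dr|_]; last first.
  by rewrite addn0.
have lt_i : (i.+1 < n)%N by case/andP: dr.
have /forallP/(_ i)/forallP/(_ (Ordinal lt_i))/implyP/(_ (ltnSn i)) := ga.
rewrite /post dr => h; have := ltn_ord (a (Ordinal lt_i)).1; lia.
Qed.

Lemma sum_compat_gapcount (R : comNzRingType) (y : R) k : (0 < n)%N ->
  \sum_(a : {ffun 'I_n -> letter k} | compat (@letter_key k) snd s a)
     y ^+ (\sum_i (a i).2)%N
  = gapcount asc_left desc_right y n k.
Proof.
move=> n_gt0; rewrite -(@sum_gaps asc_left desc_right R y erefl k n k (leqnn k)).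
apply: eq_bigl => a.
rewrite compat_gaps; apply/idP/andP => [ga|[]//].
by split=> //; apply: gaps_below.
Qed.

Lemma des_desc_right : des s = #|[set i : 'I_n | desc_right i]|.
Proof.
apply: eq_card => i; rewrite !inE.
apply/existsP/idP => [[j /andP [/eqP e]]|dr]; first by rewrite -(desc_right_succ e).
have lt_i : (i.+1 < n)%N by case/andP: dr.
by exists (Ordinal lt_i); rewrite eqxx -(@desc_right_succ i (Ordinal lt_i)).
Qed.

Lemma pk_asc_desc : pk s = #|[set i : 'I_n | asc_left i && desc_right i]|.
Proof.
apply: eq_card => i; rewrite !inE.
apply/existsP/andP => [[h /existsP [j /and4P [/eqP eh /eqP ej]]]|[al dr]].
  by rewrite -(asc_left_succ eh) -(desc_right_succ ej).
have lt_i : (i.+1 < n)%N by case/andP: dr.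
have lt_h : (i.-1 < n)%N by have := ltn_ord i; lia.
have eh : i = i.-1.+1 :> nat by case/and3P: al; case: (i : nat).
exists (Ordinal lt_h); apply/existsP; exists (Ordinal lt_i).
rewrite -(@asc_left_succ (Ordinal lt_h) i) // -(@desc_right_succ i (Ordinal lt_i)) //.
by rewrite al dr /= -eh !eqxx.
Qed.

(** Each step is a descent on the right of its left end or an ascent on the left of
    its right end, and not both. *)
Lemma sum_asc_desc m : (m < n)%N ->
  (\sum_(i < m.+1) asc_left i + \sum_(i < m) desc_right i = m)%N.
Proof.
elim: m => [|m IH] lt_mn; first by rewrite big_ord_recl !big_ord0.
rewrite big_ord_recr [X in (_ + X)%N]big_ord_recr /= addnACA IH ?(ltnW lt_mn) //.
rewrite /asc_left /desc_right lt_mn /=.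
have : value m != value m.+1.
  rewrite (valueE (Ordinal lt_mn)) (valueE (Ordinal (ltnW lt_mn))).
  by rewrite (inj_eq val_inj) (inj_eq perm_inj) -(inj_eq val_inj) /= neq_ltn ltnSn.
by case: ltngtP => //; rewrite addn1.
Qed.

Lemma card_asc_desc :
  (#|[set i : 'I_n | asc_left i]| + #|[set i : 'I_n | desc_right i]|)%N = n.-1.
Proof.
have cardE (P : nat -> bool) : #|[set i : 'I_n | P i]| = (\sum_(i < n) P i)%N.
  by rewrite -sum1_card big_mkcond; apply: eq_bigr => i _; rewrite inE; case: (P i).
rewrite !cardE; have [->|n_gt0] := posnP n; first by rewrite !big_ord0.
have last_desc : desc_right n.-1 = false by rewrite /desc_right prednK // ltnn.
have lt_n : (n.-1 < n)%N by rewrite prednK.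
have := sum_asc_desc lt_n; rewrite prednK // => <-; congr (_ + _)%N.
by rewrite -[in LHS](prednK n_gt0) big_ord_recr /= last_desc addn0.
Qed.

(** Positions with an ascent on the left and a descent on the right are the peaks,
    those with neither are the valleys, ends included.  Counting the n positions
    and the n - 1 steps shows that valleys exceed peaks by one; r is the number of
    double ascents. *)
Lemma prod_stats (R : comNzRingType) (F : bool -> bool -> R) : (0 < n)%N ->
  exists2 r, (n = (pk s).*2 + (des s - pk s) + r + 1)%N /\ (pk s <= des s)%N
    & \prod_(j < n) F (asc_left j) (desc_right j)
      = F true true ^+ pk s * F false true ^+ (des s - pk s)
        * F true false ^+ r * F false false ^+ (pk s).+1.
Proof.
move=> n_gt0.
pose N e f := #|[set i : 'I_n | (asc_left i == e) && (desc_right i == f)]|.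
have prodE : \prod_(j < n) F (asc_left j) (desc_right j) =
    F true true ^+ N true true * F false true ^+ N false true
    * F true false ^+ N true false * F false false ^+ N false false.
  rewrite (partition_big (fun j : 'I_n => (asc_left j, desc_right j)) predT) //=.
  rewrite -(pair_bigA _ (fun e f => \prod_(i < n | (asc_left i, desc_right i) == (e, f))
     F (asc_left i) (desc_right i))) !big_bool /=.
  have E e f : \prod_(i < n | (asc_left i, desc_right i) == (e, f))
     F (asc_left i) (desc_right i) = F e f ^+ N e f.
    rewrite (eq_bigr (fun=> F e f)) => [|i /eqP [-> ->] //].
    rewrite -[N e f]/(#|_|) -prodr_const; apply: eq_bigl => i.
    by rewrite inE xpair_eqE.
  rewrite !E /=; ring.
have N11 : N true true = pk s.
  by rewrite pk_asc_desc; apply: eq_card => i; rewrite !inE !eqb_id.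
have splitE (P Q : pred 'I_n) : #|[set i | P i]| =
    (#|[set i | P i && Q i]| + #|[set i | P i && ~~ Q i]|)%N.
  rewrite -(cardsID [set i | Q i]); congr (_ + _)%N; apply: eq_card => i; rewrite !inE //.
  by rewrite andbC.
have Nd : des s = (N true true + N false true)%N.
  rewrite des_desc_right (splitE _ (fun i : 'I_n => asc_left i)); congr (_ + _)%N;
    by apply: eq_card => i; rewrite !inE; case: (asc_left i); case: (desc_right i).
have Na : #|[set i : 'I_n | asc_left i]| = (N true true + N true false)%N.
  rewrite (splitE _ (fun i : 'I_n => desc_right i)); congr (_ + _)%N;
    by apply: eq_card => i; rewrite !inE; case: (asc_left i); case: (desc_right i).
have Nn : #|[set i : 'I_n | ~~ asc_left i]| = (N false true + N false false)%N.
  rewrite (splitE _ (fun i : 'I_n => desc_right i)); congr (_ + _)%N;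
    by apply: eq_card => i; rewrite !inE; case: (asc_left i); case: (desc_right i).
have NT : (#|[set i : 'I_n | asc_left i]| + #|[set i : 'I_n | ~~ asc_left i]|)%N = n.
  by rewrite -[RHS]card_ord -cardsT (splitE predT (fun i : 'I_n => asc_left i)).
have := card_asc_desc; rewrite -des_desc_right => cad.
exists (N true false); first by lia.
rewrite prodE N11; congr (_ * _ ^+ _ * _ * _ ^+ _); lia.
Qed.

End PermStats.

(** * Coefficients of the two sides *)

Section Constants.
Variable R : comNzRingType.

(** A series in x whose coefficients do not involve t. *)
Definition fps_const (f : {fps R}) : {fps {fps R}} := FPS (fun n => fpsC (fcoef f n)).

Fact fps_const_is_zmod_morphism : zmod_morphism fps_const.
Proof. by move=> f g; apply/fpsP => n; rewrite /= rmorphB. Qed.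

Fact fps_const_is_monoid_morphism : monoid_morphism fps_const.
Proof.
split=> [|f g]; apply/fpsP => n; first by rewrite /= (fun_if (@fpsC R)) rmorph1 rmorph0.
by rewrite /= rmorph_sum; apply: eq_bigr => i _; rewrite rmorphM.
Qed.

HB.instance Definition _ :=
  GRing.isZmodMorphism.Build {fps R} {fps {fps R}} fps_const
    fps_const_is_zmod_morphism.
HB.instance Definition _ :=
  GRing.isMonoidMorphism.Build {fps R} {fps {fps R}} fps_const
    fps_const_is_monoid_morphism.

Lemma fps_constC c : fps_const (fpsC c) = fpsC (fpsC c).
Proof. by apply/fpsP => n; rewrite /= (fun_if (@fpsC R)) rmorph0. Qed.

Lemma fps_constX : fps_const fpsX = fpsX.
Proof. by apply/fpsP => n; rewrite /= rmorph_nat. Qed.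

Lemma fsum_single (V : nmodType) m n (f : nat -> V) : (forall k, k != n -> f k = 0) ->
  \sum_(k \in [set k | (m <= k)%N]%classic) f k = if (m <= n)%N then f n else 0.
Proof.
move=> f0; case: leqP => [le_mn|lt_nm].
  rewrite -(fsbig_widen [set n]%classic) ?fsbig_set1 // => [k /= -> //|k /= [_ /eqP]].
  exact: f0.
by apply: fsbig1 => k /= le_mk; apply: f0; rewrite neq_ltn (leq_trans lt_nm) // orbT.
Qed.

Lemma coef_sum_x (g : nat -> {fps R}) m n :
  fcoef (fps_sum m (fun k => fpsC (g k) * fpsX ^+ k)) n = if (m <= n)%N then g n else 0.
Proof.
apply/fpsP => j /=; rewrite (@fsum_single _ m n) => [|k neq_kn]; last first.
  rewrite /coef_xt fcoefMXn; case: ltngtP neq_kn => //= lt_kn _.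
  by rewrite subn_eq0 leqNgt lt_kn.
by rewrite /coef_xt fcoefMXn ltnn subnn /=; case: leqP.
Qed.

Lemma coef_sum_t (h : nat -> {fps R}) n :
  fcoef (fps_sum 0 (fun k => fps_const (h k) * fpsC (fpsX ^+ k))) n
  = FPS (fun k => fcoef (h k) n).
Proof.
have E k j : coef_xt (fps_const (h k) * fpsC (fpsX ^+ k)) n j =
    fcoef (h k) n * (j == k)%:R.
  by rewrite /coef_xt mulrC fcoefCM mulrC /= -[LHS]/(fcoef (fpsC _ * _) j) fcoefCM fcoefXn.
apply/fpsP => j /=; rewrite (@fsum_single _ 0 j) => [|k neq_kj].
  by rewrite leq0n E eqxx mulr1.
by rewrite E eq_sym (negPf neq_kj) mulr0.
Qed.

End Constants.

Lemma rmorph_I_pk_des_fix (R S : comNzRingType) (f : {rmorphism R -> S}) n (y t z : R) :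
  f (I_pk_des_fix n y t z) = I_pk_des_fix n (f y) (f t) (f z).
Proof.
by rewrite rmorph_sum; apply: eq_bigr => s _; rewrite !rmorphM !rmorphXn.
Qed.

Lemma fps_const_div (R : comUnitRingType) (f g : {fps R}) : g \is a GRing.unit ->
  fps_const (f / g) = fps_const f / fps_const g.
Proof. exact: rmorph_div. Qed.

Lemma fpsC_div (R : comUnitRingType) (f g : R) : g \is a GRing.unit ->
  fpsC (f / g) = fpsC f / fpsC g.
Proof. exact: rmorph_div. Qed.

(** The cancellation behind the change of variables: with a = 1 + y, b = y + t,
    c = 1 + yt and d = 1 - t, the new variables yp and td satisfy td c = b and
    yp td c^2 = a^2 t, and n + 1 = 2 (p + 1) + q + r factors c are available. *)
Lemma stats_algebra (S : comUnitRingType) (a b c d t yp td : S) p q r n :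
    a \is a GRing.unit -> d \is a GRing.unit ->
    td * c = b -> yp * td * c ^+ 2 = a ^+ 2 * t -> n = (p.*2 + q + r + 1)%N ->
  a^-1 * ((c / d) ^+ n.+1 * (yp ^+ p.+1 * td ^+ (p + q).+1)) * d ^+ n.+1
  = t * ((a * t) ^+ p * b ^+ q * c ^+ r * a ^+ p.+1).
Proof.
move=> ua ud <- Eyt ->; rewrite -!mulrA; apply: (canLR (mulKr ua)).
have -> : (c / d) ^+ (p.*2 + q + r + 1).+1 = (c ^+ 2) ^+ p.+1 * c ^+ q * c ^+ r
    * d^-1 ^+ (p.*2 + q + r + 1).+1.
  rewrite exprMn -exprM -!exprD; congr (_ ^+ _ * _); lia.
set m := (p.*2 + q + r + 1).+1.
have dd : d^-1 ^+ m * d ^+ m = 1 by rewrite -exprMn mulVr // expr1n.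
rewrite -addSn exprD.
transitivity ((yp * td * c ^+ 2) ^+ p.+1 * (td * c) ^+ q * c ^+ r * (d^-1 ^+ m * d ^+ m)).
  rewrite [in RHS]exprMn [(yp * td) ^+ _]exprMn [(td * c) ^+ q]exprMn.
  move: (yp ^+ _) (td ^+ p.+1) (td ^+ q) ((c ^+ 2) ^+ _) (c ^+ q) (c ^+ r) (_ ^+ m) (d ^+ m).
  by move=> *; ring.
rewrite dd mulr1 Eyt exprMn [(a * t) ^+ p]exprMn [t ^+ p.+1]exprS exprAC [(a ^+ _) ^+ 2]expr2.
rewrite {1}[a ^+ p.+1]exprS.
move: (a ^+ p.+1) (a ^+ p) (t ^+ p) (_ ^+ q) (c ^+ r) => *; ring.
Qed.

Section Identity.
Variables (R : comUnitRingType) (y z : R).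
Hypotheses (y_unit : y \is a GRing.unit) (y1_unit : 1 + y \is a GRing.unit).

Local Notation Y := (@fpsC R y).
Local Notation Z := (@fpsC R z).
Local Notation T := (@fpsX R).

Let unit_1DY : 1 + Y \is a GRing.unit. Proof. by rewrite fps_unitE fcoefD fcoef1. Qed.
Let unit_YDT : Y + T \is a GRing.unit. Proof. by rewrite fps_unitE fcoefD /= addr0. Qed.
Let unit_1DYT : 1 + Y * T \is a GRing.unit.
Proof. by rewrite fps_unitE fcoefD fcoefM0 fcoef1 /= mulr0 addr0 unitr1. Qed.
Let unit_1BT : 1 - T \is a GRing.unit.
Proof. by rewrite fps_unitE fcoefD fcoefN fcoef1 /= subr0 unitr1. Qed.

Local Notation Ypk := ((1 + Y) ^+ 2 * T / ((Y + T) * (1 + Y * T))).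
Local Notation Tdes := ((Y + T) / (1 + Y * T)).

(** The contribution of one permutation to the left side. *)
Lemma perm_series n (s : 'S_n) : (0 < n)%N ->
  (1 + Y)^-1 * (((1 + Y * T) / (1 - T)) ^+ n.+1 * (Ypk ^+ (pk s).+1 * Tdes ^+ (des s).+1))
  = FPS (gapcount (asc_left s) (desc_right s) y n).
Proof.
move=> n_gt0; apply: (mulIr (unitrX n.+1 unit_1BT)).
rewrite gapcount_series //.
have [r [En le_pd] ->] := prod_stats s (fun e f : bool => Y * T ^+ e + T ^+ f) n_gt0.
rewrite !expr0 [T ^+ true]expr1 !mulr1.
rewrite [Y * T + T](_ : _ = (1 + Y) * T); last by rewrite mulrDl mul1r addrC.
rewrite [Y * T + 1]addrC [Y + 1]addrC -{1}(subnKC le_pd).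
apply: stats_algebra => //; first by rewrite divrK.
rewrite -mulrA.
have -> : Tdes * (1 + Y * T) ^+ 2 = (Y + T) * (1 + Y * T) by rewrite expr2 mulrA divrK.
by rewrite divrK // unitrM unit_YDT.
Qed.

(** The coefficients of x^n, n > 0, on the two sides. *)
Lemma involution_series n : (0 < n)%N ->
  (1 + Y)^-1 * (((1 + Y * T) / (1 - T)) ^+ n.+1 * I_pk_des_fix n Ypk Tdes Z)
  = FPS (fun k => fcoef (level_series y z k) n).
Proof.
move=> n_gt0; transitivity (\sum_(s : 'S_n | involution s)
    fpsC (z ^+ fixpts s) * FPS (gapcount (asc_left s) (desc_right s) y n)).
  rewrite /I_pk_des_fix !mulr_sumr; apply: eq_bigr => s _.
  by rewrite -perm_series // rmorphXn; ring.
apply/fpsP => k; rewrite fcoef_sum -[RHS]/(fcoef (level_series y z k) n).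
rewrite -prod_cell_letters.
rewrite coef_prod_cell; last exact: letter_key_inj.
apply: eq_bigr => s _; rewrite fcoefCM -mulr_sumr; congr (_ * _).
by rewrite sum_compat_gapcount.
Qed.

(** The change of variables divides by 1 + y and by y + t, whose constant term in
    t is y.  The coefficient of x^0 is apart: it is the separate term 1/(1 - t) on
    the left, and every level series has constant term 1. *)
Theorem involution_identity :
  let y := fpsC Y in let z := fpsC Z in let t : {fps {fps R}} := fpsC T in
  let x : {fps {fps R}} := fpsX in
  1 / (1 - t)
    + 1 / (1 + y) *
      (\fps_sum_(1 <= n)
         (((1 + y * t) / (1 - t)) ^+ n.+1
          * I_pk_des_fix n ((1 + y) ^+ 2 * t / ((y + t) * (1 + y * t)))
                           ((y + t) / (1 + y * t)) z
          * x ^+ n))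
  = \fps_sum_(0 <= k)
      ((1 + z * x * y) ^+ k * (1 + x ^+ 2 * y) ^+ (k ^ 2) * t ^+ k
       / ((1 - z * x) ^+ k * (1 - x ^+ 2) ^+ 'C(k, 2)
          * (1 - x ^+ 2 * y ^+ 2) ^+ 'C(k.+1, 2))).
Proof.
move=> y' z' t x.
pose g n := ((1 + Y * T) / (1 - T)) ^+ n.+1 * I_pk_des_fix n Ypk Tdes Z.
have -> : (fun n => ((1 + y' * t) / (1 - t)) ^+ n.+1
          * I_pk_des_fix n ((1 + y') ^+ 2 * t / ((y' + t) * (1 + y' * t)))
                           ((y' + t) / (1 + y' * t)) z' * x ^+ n)
    = (fun n => fpsC (g n) * fpsX ^+ n).
  have cM : {morph @fpsC {fps R} : f g / f * g} := rmorphM _.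
  have cX m : {morph @fpsC {fps R} : f / f ^+ m} := rmorphXn _ m.
  have cD : {morph @fpsC {fps R} : f g / f + g} := rmorphD _.
  have cB : {morph @fpsC {fps R} : f g / f - g} := rmorphB _.
  have c1 : fpsC (1 : {fps R}) = 1 := rmorph1 _.
  have cI n := @rmorph_I_pk_des_fix _ _ (@fpsC {fps R}) n.
  apply/funext => n; congr (_ * _); rewrite /g cM cX.
  have -> : fpsC (I_pk_des_fix n Ypk Tdes Z)
    = I_pk_des_fix n (fpsC Ypk) (fpsC Tdes) z' := cI _ _ _ _.
  have unit_den : (Y + T) * (1 + Y * T) \is a GRing.unit by rewrite unitrM unit_YDT.
  rewrite (fpsC_div _ unit_1BT) (fpsC_div _ unit_1DYT) (fpsC_div _ unit_den).
  by rewrite [fpsC (_ ^+ 2 * _)]cM cX [fpsC (_ * (1 + _))]cM cB !cD !cM c1.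
have -> : (fun k => (1 + z' * x * y') ^+ k * (1 + x ^+ 2 * y') ^+ (k ^ 2) * t ^+ k
       / ((1 - z' * x) ^+ k * (1 - x ^+ 2) ^+ 'C(k, 2)
          * (1 - x ^+ 2 * y' ^+ 2) ^+ 'C(k.+1, 2)))
    = (fun k => fps_const (level_series y z k) * fpsC (fpsX ^+ k)).
  apply/funext => k.
  have cM : {morph @fps_const R : f g / f * g} := rmorphM _.
  have cX m : {morph @fps_const R : f / f ^+ m} := rmorphXn _ m.
  have cD : {morph @fps_const R : f g / f + g} := rmorphD _.
  have cB : {morph @fps_const R : f g / f - g} := rmorphB _.
  have c1 : fps_const (1 : {fps R}) = 1 := rmorph1 _.
  have e1 : 1 - z' * x = fps_const (1 - Z * T) by rewrite cB c1 cM fps_constC fps_constX.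
  have e2 : 1 - x ^+ 2 = fps_const (1 - T ^+ 2) by rewrite cB c1 cX fps_constX.
  have e3 : 1 - x ^+ 2 * y' ^+ 2 = fps_const (1 - fpsC (y ^+ 2) * T ^+ 2).
    rewrite cB c1 cM cX fps_constC fps_constX mulrC.
    by rewrite (rmorphXn (@fpsC R)) (rmorphXn (@fpsC {fps R})).
  have e4 : 1 + z' * x * y' = fps_const (1 + fpsC (z * y) * T).
    rewrite cD c1 cM fps_constC fps_constX mulrAC.
    by rewrite (rmorphM (@fpsC R)) (rmorphM (@fpsC {fps R})).
  have e5 : 1 + x ^+ 2 * y' = fps_const (1 + Y * T ^+ 2).
    by rewrite cD c1 cM cX fps_constC fps_constX mulrC.
  rewrite /level_series fps_const_div ?level_den_unit // /level_num /level_den.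
  by rewrite !cM !cX -e1 -e2 -e3 -e4 -e5 (rmorphXn (@fpsC {fps R})) mulrAC.
apply/fpsP => n; rewrite fcoefD coef_sum_t.
have -> : 1 / (1 + y') = fpsC ((1 + Y)^-1) by rewrite mul1r rmorphV // rmorphD rmorph1.
have -> : 1 / (1 - t) = fpsC ((1 - T)^-1) by rewrite mul1r rmorphV // rmorphB rmorph1.
rewrite fcoefCM coef_sum_x.
case: n => [|n]; last by rewrite /= add0r -involution_series.
have -> : FPS (fun k => fcoef (level_series y z k) 0) = FPS (fun=> 1).
  by apply/fpsP => k; apply: level_series0.
rewrite /= mulr0 addr0; apply: (mulIr unit_1BT); rewrite mulVr //.
apply/fpsP => k; rewrite mulrBr mulr1 fcoefD fcoefN fcoefMX fcoef1 /=.
by case: k => [|k]; rewrite ?subr0 ?subrr.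
Qed.

End Identity.

Theorem theorem5p1 :
  let y := vy in let z := vz in let t := vt in let x := vx in
  1 / (1 - t)
    + 1 / (1 + y) *
      (\fps_sum_(1 <= n)
         (((1 + y * t) / (1 - t)) ^+ n.+1
          * I_pk_des_fix n ((1 + y) ^+ 2 * t / ((y + t) * (1 + y * t)))
                           ((y + t) / (1 + y * t)) z
          * x ^+ n))
  = \fps_sum_(0 <= k)
      ((1 + z * x * y) ^+ k * (1 + x ^+ 2 * y) ^+ (k ^ 2) * t ^+ k
       / ((1 - z * x) ^+ k * (1 - x ^+ 2) ^+ 'C(k, 2)
          * (1 - x ^+ 2 * y ^+ 2) ^+ 'C(k.+1, 2))).
Proof.
apply: involution_identity; first exact: fps_unit_vy.
exact: fps_unit_1Dy.
Qed.
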